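(* Let $k$ be any field, let $X\subset\mathbb{P}^{n+e}_k$ be a nondegenerate variety of dimension $n$ and codimension $e$, and let $q\in X$ be any closed point. Let $X_q\subset\mathbb{P}^{n+e-1}$ be the inner projection of $X$ from $q$. Then for any $p\ge 1$, $$\beta_{p,1}(X)\le \beta_{p,1}(X_q)+\beta_{p-1,1}(X_q)+\binom{e}{p}.$$
   Context: A variety over $k$ is an irreducible and reduced closed subscheme of projective space $\mathbb{P}^N_k$ (here $N=n+e$). A closed subscheme $X\subset\mathbb{P}^N$ with homogeneous ideal $I_X\subset R=k[x_0,\dots,x_N]$ is nondegenerate if $I_X$ contains no linear forms. Put $R_X=R/I_X$ and define the graded Betti numbers $\beta_{p,q}(X):=\dim_k \mathrm{Tor}^R_p(R_X,k)_{p+q}$. Inner projection: for a closed point $q\in X$, after a linear change of coordinates take $q=(1:0:\cdots:0)$ and let $S=k[x_1,\dots,x_N]$. Then $X_q\subset\mathbb{P}^{N-1}=\mathrm{Proj}(S)$ is the Zariski closure of the image of the linear projection $\pi_q:X\setminus\{q\}\to\mathbb{P}^{N-1}$ from $q$, with defining ideal $I_X\cap S$. The Betti numbers of $X_q$ are computed over $S$: $\beta_{p,j}(X_q)=\dim_k\mathrm{Tor}^S_p(S/(I_X\cap S),k)_{p+j}$. *)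

(* Defs.v *)
From HB Require Import structures.
From mathcomp Require Import all_boot all_order all_algebra.
From mathcomp Require Export mpoly.

Set Implicit Arguments.
Unset Strict Implicit.
Unset Printing Implicit Defensive.

Import GRing.Theory.
Local Open Scope ring_scope.

Section ProjectiveVarieties.
Variables (k : fieldType) (N : nat).
Notation R := {mpoly k[N.+1]}.
Implicit Types I P : {pred R}.

Definition homogeneous_ideal I : Prop :=
  idealr_closed I /\
  forall f, f \in I -> forall d, pihomog mdeg d f \in I.

(* Integral closed subschemes of P^N correspond to the homogeneous primes that
   do not contain the irrelevant ideal; these are also the points of P^N. *)
Definition is_variety I : Prop :=
  [/\ homogeneous_ideal I, prime_idealr_closed I & exists i, 'X_i \notin I].

Definition nondegenerate_ideal I : Prop :=
  forall f : R, f \is 1.-homog -> f \in I -> f = 0.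

(* Chains P_0 < ... < P_d of points of Proj (R/I), i.e. of irreducible closed
   subsets of the closed subscheme defined by I. *)
Definition has_chain I (d : nat) : Prop :=
  exists P : nat -> {pred R},
    (forall i, (i <= d)%N -> is_variety (P i) /\ {subset I <= P i}) /\
    (forall i, (i < d)%N ->
       {subset P i <= P i.+1} /\ ~ {subset P i.+1 <= P i}).

Definition has_dim I (n : nat) : Prop :=
  has_chain I n /\ forall d, has_chain I d -> (d <= n)%N.

(* Points rational over k are given by homogeneous coordinates. *)
Definition on_variety I (q : 'cV[k]_N.+1) : Prop :=
  q != 0 /\ forall f, f \in I -> f.@[fun i => q i ord0] = 0.

(* f(x) |-> f(A x) *)
Definition lin_subst (A : 'M[k]_N.+1) (f : R) : R :=
  f \mPo [tuple \sum_j A i j *: 'X_j | i < N.+1].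

(* The ideal in the coordinates y, where x = A y. *)
Definition coord_change (A : 'M[k]_N.+1) I : {pred R} :=
  [pred f | lin_subst (invmx A) f \in I].

(* The inclusion k[x_1, ..., x_N] -> k[x_0, ..., x_N]; variable i of the source
   is x_(i+1). *)
Definition S_incl (h : {mpoly k[N]}) : R :=
  h \mPo [tuple 'X_(lift ord0 i) | i < N].

(* The ideal of the projection from the point A (1 : 0 : ... : 0)^T, in the
   coordinates y where x = A y. *)
Definition inner_projection (A : 'M[k]_N.+1) I : {pred {mpoly k[N]}} :=
  [pred h | S_incl h \in coord_change A I].

End ProjectiveVarieties.

Section GradedBettiNumbers.
Variables (k : fieldType) (m : nat).
Notation R := {mpoly k[m]}.

(* Graded resolutions ... -> F_1 -> F_0 -> R/I -> 0 by free modules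
   F_i = sum_a R(- res_deg a) of finite rank. Elements of F_i are row vectors
   and maps act by right multiplication; res_aug lifts F_0 -> R/I to R. *)
Record graded_resolution (I : {pred R}) := GradedResolution {
  res_rank : nat -> nat;
  res_deg : forall i, 'I_(res_rank i) -> nat;
  res_diff : forall i, 'M[R]_(res_rank i.+1, res_rank i);
  res_aug : 'cV[R]_(res_rank 0);
  res_diff_homog : forall i a b mon, mon \in msupp (res_diff i a b) ->
    (mdeg mon + res_deg b)%N = res_deg a;
  res_aug_homog : forall a mon, mon \in msupp (res_aug a ord0) ->
    mdeg mon = res_deg a;
  res_aug_surj : forall f : R, exists u : 'rV[R]_(res_rank 0),
    (u *m res_aug) ord0 ord0 - f \in I;
  res_exact0 : forall u : 'rV[R]_(res_rank 0),
    (u *m res_aug) ord0 ord0 \in I <-> exists v, u = v *m res_diff 0;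
  res_exact : forall i (u : 'rV[R]_(res_rank i.+1)),
    u *m res_diff i = 0 <-> exists v, u = v *m res_diff i.+1
}.

Section Tor.
Variables (I : {pred R}) (F : graded_resolution I).

Definition tor_diff p : 'M[k]_(res_rank F p.+1, res_rank F p) :=
  map_mx (mcoeff 0%MM) (res_diff F p).

(* The degree j part of F_p (x) k is spanned by the generators of degree j, as
   k = R/(x) is concentrated in degree 0. *)
Definition tor_piece p j : 'M[k]_(res_rank F p) :=
  diag_mx (\row_a (res_deg (g := F) a == j)%:R).

Definition tor_cycles p j : 'M[k]_(res_rank F p) :=
  (if p is p'.+1 as p0 return 'M[k]_(res_rank F p0)
   then tor_piece p'.+1 j :&: kermx (tor_diff p')
   else tor_piece 0 j)%MS.

Definition tor_boundaries p j : 'M[k]_(res_rank F p.+1, res_rank F p) :=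
  tor_piece p.+1 j *m tor_diff p.

(* dim_k Tor_p (R/I, k)_(p+q), the dimension of the degree p+q part of
   H_p (F (x) k); see tor_boundaries_cycles for the subtraction. *)
Definition betti p q : nat :=
  (\rank (tor_cycles p (p + q)) - \rank (tor_boundaries p (p + q)))%N.

Lemma tor_diff_piece p j :
  tor_piece p.+1 j *m tor_diff p = tor_diff p *m tor_piece p j.
Proof.
rewrite mul_diag_mx mul_mx_diag; apply/matrixP => a b; rewrite !mxE.
have [z|nz] := eqVneq (mcoeff 0%MM (res_diff F p a b)) 0.
  by rewrite z mulr0 mul0r.
have := @res_diff_homog I F p a b 0%MM; rewrite mcoeff_msupp => /(_ nz).
by rewrite mdeg0 add0n => ->; rewrite mulrC.
Qed.

Lemma tor_diffK p : tor_diff p.+1 *m tor_diff p = 0.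
Proof.
rewrite -map_mxM (_ : res_diff F p.+1 *m res_diff F p = 0) ?map_mx0 //.
apply/row_matrixP => a; rewrite row_mul row0.
by apply/res_exact; exists (delta_mx 0 a); rewrite rowE.
Qed.

Lemma tor_boundaries_cycles p j : (tor_boundaries p j <= tor_cycles p j)%MS.
Proof.
case: p => [|p]; rewrite /tor_boundaries /tor_cycles.
  by rewrite tor_diff_piece submxMl.
rewrite sub_capmx {1}tor_diff_piece submxMl /=.
by apply/sub_kermxP; rewrite -mulmxA tor_diffK mulmx0.
Qed.

End Tor.
End GradedBettiNumbers.

(* Main.v *)
(** Both graded Betti numbers are read off from quadrics: for p >= 1 and an ideal
    I without linear forms, Tor_p(R/I, k)_(p+1) is the kernel of
    \wedge^(p-1) V (x) I_2 -> \wedge^(p-2) V (x) R_3, where V = R_1. The comparison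
    with an arbitrary free resolution F is the zigzag of the double complex
    (Koszul complex) (x) F.

    Choose coordinates with q = (1 : 0 : ... : 0). Splitting \wedge V along x_0, such a
    syzygy of I_2 is given by a pair (alpha, beta); the coefficient of x_0^2 shows
    that beta involves no x_0, so that beta is a syzygy of J_2 for J = I \cap S, one step
    lower. If beta = 0, the x_0-part of alpha is a cycle of \wedge^(p-1) W (x) L, where W
    is spanned by x_1, ..., x_N and L \subset W is the space of linear forms l with
    x_0 l + h in I_2 for some h in S; these cycles form \wedge^p L. What remains is a
    syzygy of J_2.

    It remains to see that t := dim L is at most e. The forms of L are equations of
    the tangent space at q, so some t x t minor of the Jacobian matrix of quadrics in I
    does not vanish on X. Hence the function field of the cone over X is algebraic over
    the subfield generated by the N + 1 - t other coordinates (in the relation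
    det (Z_i - x_i) \in (f_j(Z), Z_l - x_l) a transcendental x_i could be replaced by an
    indeterminate, which is absurd at Z = x), whereas a chain of primes of length n
    provides n + 1 algebraically independent elements. *)

From HB Require Import structures.
Require Import Defs.
From mathcomp Require Import all_boot all_order all_algebra.
From mathcomp Require Import zify ring.
From Stdlib Require Import Classical.

Set Implicit Arguments.
Unset Strict Implicit.
Unset Printing Implicit Defensive.

Import GRing.Theory.
Local Open Scope ring_scope.

(** * The Koszul complex *)

(** F and G are arbitrary graded resolutions, possibly not minimal, so Betti numbers cannot be read
    off from their ranks. The explicit space of linear syzygies bounds them from above for X and
    from below for the projection.

    The field is arbitrary too. A Koszul homotopy built from the Euler derivation would divide by
    degrees; here monomials are divided by their least variable instead. Likewise, divided
    differences in a second set of variables Z replace any separability argument in the Jacobian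
    criterion.

    The delicate point there is that the cofactors in the relation for det (Z_i - x_i) have
    coefficients involving all the x's, where replacing x_i by an indeterminate makes no sense. They
    are expanded along a basis of their coefficients over the field generated by x_i and the free
    coordinates. Each component then only involves f_j(Z), Z_i - x_i and Z_l - x_l, which are
    defined over that field.

    The binomial coefficient counts the p-element subsets of t pivots of L, and t <= e is the count
    (n + 1) + t <= (n + e) + 1. *)

Lemma ltn_ord_eqF m (i j : 'I_m) : (i < j)%N -> (i == j) = false.
Proof. by move=> ij; rewrite -val_eqE ltn_eqF. Qed.

Lemma gtn_ord_eqF m (i j : 'I_m) : (i < j)%N -> (j == i) = false.
Proof. by move=> ij; rewrite -val_eqE gtn_eqF. Qed.

Section LeastVariable.
Variables (m : nat) (k : fieldType).
Implicit Types (f g : {mpoly k[m]}) (i j : 'I_m) (mu : 'X_{1..m}).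

Definition vanish_below i mu := [forall j : 'I_m, (j < i)%N ==> (mu j == 0%N)].

(** The monomials of f whose least variable is X_i, divided by X_i. Splitting f by least variables
    involves no division in k, so it works in every characteristic. *)
Definition least_div i f : {mpoly k[m]} :=
  \sum_(mu <- msupp f | vanish_below i mu && (mu i != 0%N))
     f@_mu *: 'X_[mu - U_(i)].

Lemma vanish_below_addU i mu : vanish_below i (mu + U_(i)) = vanish_below i mu.
Proof.
rewrite /vanish_below; apply: eq_forallb => j; case: ltnP => //= ji.
by rewrite mnmDE mnm1E gtn_ord_eqF ?addn0.
Qed.

Lemma mcoeff_least_div i f mu :
  (least_div i f)@_mu = (f@_(mu + U_(i)) *+ vanish_below i mu).
Proof.
rewrite /least_div raddf_sum /=.
have E nu : vanish_below i nu && (nu i != 0%N) ->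
    (f@_nu *: 'X_[nu - U_(i)])@_mu = f@_nu *+ (nu == (mu + U_(i))%MM).
  case/andP => _ nz; rewrite mcoeffZ mcoeffX -[RHS]mulr_natr; congr (_ * _ %:R).
  congr nat_of_bool; apply/eqP/eqP => [<-|->]; last by rewrite addmK.
  by rewrite submK // lep1mP.
rewrite (eq_bigr _ E) big_mkcond /=.
have [in_f|] := boolP ((mu + U_(i))%MM \in msupp f); last first.
  move=> nin; rewrite memN_msupp_eq0 // mul0rn big_seq big1 // => nu nu_f.
  case: ifP => // _; case: eqP => [e|_]; last by rewrite mulr0n.
  by rewrite -e nu_f in nin.
rewrite (bigD1_seq _ in_f) ?msupp_uniq //= eqxx vanish_below_addU.
rewrite big1 ?addr0 => [|nu /negPf ->]; last by rewrite mulr0n if_same.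
rewrite mnmDE mnm1E eqxx addn1 andbT.
by case: ifP.
Qed.

Lemma mcoeffXM i f mu :
  ('X_i * f)@_mu = f@_(mu - U_(i)) *+ (mu i != 0%N).
Proof.
case: eqP => /= [z|/eqP nz].
  rewrite mulr0n; apply: memN_msupp_eq0; rewrite mulrC (perm_mem (msuppMX f U_(i))).
  apply/mapP => -[nu _ e]; move: z; rewrite e mnmDE mnm1E eqxx; lia.
by rewrite mulr1n mulrC -{1}(submK (_ : U_(i) <= mu)%MM) ?lep1mP // addmC mcoeffMX.
Qed.

Lemma least_div_is_linear i : linear (least_div i).
Proof.
move=> c f g; apply/mpolyP => mu.
by rewrite mcoeff_least_div !mcoeffD !mcoeffZ !mcoeff_least_div mulrnDl mulrnAr.
Qed.

HB.instance Definition _ i :=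
  GRing.isLinear.Build k {mpoly k[m]} {mpoly k[m]} _ (least_div i)
    (least_div_is_linear i).

Lemma least_divX i j f : (i < j)%N ->
  least_div i ('X_j * f) = 'X_j * least_div i f.
Proof.
move=> ij; apply/mpolyP => mu.
rewrite mcoeff_least_div !mcoeffXM mcoeff_least_div mnmDE mnm1E ltn_ord_eqF //=.
rewrite addn0; case: eqP => [_|/eqP nz]; first by rewrite !mulr0n mul0rn.
rewrite !mulr1n; have le : (U_(j) <= mu)%MM by rewrite lep1mP.
have -> : vanish_below i (mu - U_(j)) = vanish_below i mu.
  rewrite /vanish_below; apply: eq_forallb => l; case: (ltnP l i) => //= li.
  by rewrite mnmBE mnm1E gtn_ord_eqF ?(ltn_trans li) // subn0.
by rewrite [in RHS]addmC addmBA // addmC.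
Qed.

Lemma least_divX0 i j f : (j < i)%N -> least_div i ('X_j * f) = 0.
Proof.
move=> ji; apply/mpolyP => mu; rewrite mcoeff_least_div mcoeffXM mcoeff0.
rewrite mnmDE mnm1E gtn_ord_eqF // addn0; case: eqP => [_|/eqP nz].
  by rewrite mulr0n mul0rn.
rewrite (_ : vanish_below i mu = false) ?mulr0n //.
by apply/negP => /forallP/(_ j); rewrite ji (negPf nz).
Qed.

Lemma mcoeff_XM_least_div i f mu :
  ('X_i * least_div i f)@_mu = f@_mu *+ (vanish_below i mu && (mu i != 0%N)).
Proof.
rewrite mcoeffXM mcoeff_least_div; case: eqP => [_|/eqP nz]; first by rewrite andbF.
have le : (U_(i) <= mu)%MM by rewrite lep1mP.
by rewrite mulr1n submK // -vanish_below_addU submK // andbT.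
Qed.

(** A nonconstant monomial has exactly one least variable: either it is some X_j with j < i, or the
    monomial vanishes below i. *)
Lemma vanish_below_sum mu i :
  (\sum_(j < m | (j < i)%N) (vanish_below j mu && (mu j != 0%N)) +
    vanish_below i mu = 1)%N.
Proof.
have [b|] := boolP (vanish_below i mu).
  rewrite big1 // => j ji; move/forallP/(_ j): b; rewrite ji => /eqP ->.
  by rewrite andbF.
rewrite negb_forall => /existsP[j0]; rewrite negb_imply => /andP[j0i nz0].
have P0 : [pred j : 'I_m | (j < i)%N && (mu j != 0%N)] j0 by apply/andP.
case: (arg_minnP (fun j : 'I_m => j : nat) P0) => j /= /andP[ji nz] jmin.
rewrite addn0 (bigD1 j) //= nz andbT.
have -> : vanish_below j mu.
  apply/forallP => l; apply/implyP => lj; apply: contraTT isT => nzl.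
  have := jmin l; rewrite nzl (ltn_trans lj ji) /= => /(_ isT); lia.
rewrite big1 // => l /andP[li lj]; apply/eqP; rewrite eqb0.
apply/negP => /andP[/forallP bl nzl].
have jl : (j < l)%N.
  have := jmin l; rewrite nzl li /= => /(_ isT); rewrite leq_eqVlt.
  by rewrite val_eqE eq_sym (negPf lj).
by move: (bl j); rewrite jl (negPf nz).
Qed.

(** The term [least_div i ('X_i * f)] keeps exactly the monomials of f that vanish below i; the
    others are recovered from their least variable. *)
Lemma least_div_partial i f :
  \sum_(j < m | (j < i)%N) 'X_j * least_div j f + least_div i ('X_i * f) = f.
Proof.
apply/mpolyP => mu; rewrite mcoeffD raddf_sum /= mcoeff_least_div mcoeffXM.
rewrite addmK mnmDE mnm1E eqxx addn1 /= mulr1n.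
under eq_bigr do rewrite mcoeff_XM_least_div.
by rewrite sumrMnr -mulrnDr vanish_below_sum mulr1n.
Qed.

Lemma least_div_total f :
  \sum_(j < m) 'X_j * least_div j f = f - (f@_0%MM)%:MP.
Proof.
apply/mpolyP => mu; rewrite mcoeffB mcoeffC raddf_sum /=.
under eq_bigr do rewrite mcoeff_XM_least_div.
rewrite sumrMnr; have [->|nz] := eqVneq mu 0%MM.
  rewrite mulr1 subrr big1 ?mulr0n // => j _.
  by rewrite mnm0E andbF.
rewrite mulr0 subr0.
have [i0 nzi0] : exists i, mu i != 0%N.
  apply/existsP; apply: contraNT nz => /existsPn h; apply/eqP/mnmP => i.
  by rewrite mnm0E; apply/eqP; have := h i; rewrite negbK.
case: (arg_minnP (fun j : 'I_m => j : nat) (nzi0 : [pred j | mu j != 0%N] i0)).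
move=> i /= nzi imin.
rewrite (bigD1 i) //= nzi andbT.
have -> : vanish_below i mu.
  apply/forallP => l; apply/implyP => li; apply: contraTT isT => /imin; lia.
rewrite big1 // => l li; apply/eqP; rewrite eqb0.
apply/negP => /andP[/forallP bl nzl].
have il : (i < l)%N.
  by have := imin l nzl; rewrite leq_eqVlt val_eqE eq_sym (negPf li).
by move: (bl i); rewrite il (negPf nzi).
Qed.

End LeastVariable.

Section Koszul.
Variables (m : nat) (k : fieldType).
Notation R := {mpoly k[m]}.
Implicit Types (w : {set 'I_m} -> R) (S : {set 'I_m}) (i j : 'I_m).

(* A chain w stands for the sum over S of w S (x) e_S, in R (x) \wedge V. *)
Definition kpos i S := #|[set j in S | (j < i)%N]|.

Definition koszul w S : R :=
  \sum_(i | i \notin S) (-1) ^+ kpos i S * ('X_i * w (i |: S)).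

(* Contracting homotopy: if X_i is the least variable among those of X^mu and those
   indexed by S, it sends X^mu (x) e_S to (X^mu / X_i) (x) e_(i |: S) when i \notin S,
   and to 0 otherwise. *)
Definition koszul_htpy w S : R :=
  \sum_(i in S | [forall j in S, (i <= j)%N]) least_div i (w (S :\ i)).

Lemma least_div_sign i n f :
  least_div i ((-1) ^+ n * f) = (-1) ^+ n * least_div i f :> R.
Proof.
rewrite -signr_odd; case: odd; rewrite ?expr1 ?expr0 ?mul1r // !mulN1r.
exact: raddfN.
Qed.

Lemma kposU1 i j S : i != j -> i \notin S ->
  kpos j (i |: S) = ((i < j) + kpos j S)%N.
Proof.
move=> nij iS; rewrite /kpos; case: ltnP => ij.
  rewrite (_ : [set l in i |: S | (l < j)%N] = i |: [set l in S | (l < j)%N]).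
    by rewrite cardsU1 inE (negPf iS).
  by apply/setP => l; rewrite !inE; case: eqP => [->|//]; rewrite ij.
congr #|pred_of_set _|; apply/setP => l; rewrite !inE; case: eqP => [->|//].
by rewrite ltnNge ij /= andbF.
Qed.

Lemma kpos_min i S : (forall j, j \in S -> (i <= j)%N) -> kpos i S = 0%N.
Proof.
move=> h; apply/eqP; rewrite cards_eq0; apply/eqP/setP => l; rewrite !inE.
by case lS: (l \in S) => //=; rewrite ltnNge h.
Qed.

Lemma koszul_ext w w' S : (forall T, w T = w' T) -> koszul w S = koszul w' S.
Proof. by move=> e; apply: eq_bigr => i _; rewrite e. Qed.

Lemma koszul_htpy0 w : koszul_htpy w set0 = 0.
Proof. by rewrite /koszul_htpy big1 // => i; rewrite inE. Qed.

Lemma koszul_htpyU1 w i S : (forall j, j \in S -> (i < j)%N) ->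
  koszul_htpy w (i |: S) = least_div i (w S).
Proof.
move=> h; have iS : i \notin S by apply/negP => /h; rewrite ltnn.
rewrite /koszul_htpy (bigD1 i) /=; last first.
  rewrite setU11; apply/forallP => j; rewrite !inE; apply/implyP.
  by case/predU1P => [->//|/h/ltnW].
rewrite setU1K // big1 ?addr0 // => j /andP[/andP[jiS /forallP minj] nji].
move: (minj i); rewrite setU11 /= leqNgt h //.
by move: jiS; rewrite in_setU1 (negPf nji).
Qed.

Lemma set_min_split S : S != set0 ->
  exists i S', S = i |: S' /\ forall j, j \in S' -> (i < j)%N.
Proof.
case/set0Pn => i0 i0S.
case: (arg_minnP (fun j : 'I_m => j : nat) i0S) => i iS imin.
exists i, (S :\ i); rewrite setD1K //; split=> // j; rewrite !inE => /andP[nji jS].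
by rewrite ltn_neqAle imin // andbT eq_sym.
Qed.

Lemma koszul_htpyE0 w : koszul (koszul_htpy w) set0 = w set0 - ((w set0)@_0%MM)%:MP.
Proof.
rewrite -least_div_total; apply: eq_big => [i|i _]; first by rewrite inE.
rewrite kpos_min ?mul1r => [|j]; last by rewrite inE.
by rewrite koszul_htpyU1 // => j; rewrite inE.
Qed.

(** Write S as [i |: S'] with i minimal. The indices j < i and j = i contribute the two parts of
    [least_div_partial], while those above i occur in both summands with opposite signs. *)
Lemma koszul_htpyE w S : S != set0 ->
  koszul (koszul_htpy w) S + koszul_htpy (koszul w) S = w S.
Proof.
move=> /set_min_split[i [S' [-> iS']]].
have iNS : i \notin S' by apply/negP => /iS'; rewrite ltnn.
rewrite koszul_htpyU1 // {2}/koszul raddf_sum /= (bigD1 i) //=.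
rewrite kpos_min => [|j /iS'/ltnW //]; rewrite expr0 mul1r.
rewrite -[RHS](least_div_partial i) {1}/koszul (bigID (fun j : 'I_m => (j < i)%N)) /=.
set A2 := (X in _ + X + _); set B := (X in _ + (_ + X)).
(* [A2] gathers the indices above i in the differential of the homotopy. In [B], the indices below i
   give 0 by [least_divX0]; adding i to S' flips the sign of the others. *)
have eA2 : A2 = - B.
  rewrite /B (bigID (fun j : 'I_m => (j < i)%N)) /= big1 ?add0r => [|j].
    rewrite /A2 -sumrN; apply: eq_big => [j|j /andP[jS ji]].
      by rewrite in_setU1 negb_or; case: (j == i); case: (j \in S'); case: (j < i)%N.
    have [nji jS'] : j != i /\ j \notin S'.
      by apply/andP; rewrite -negb_or -in_setU1.
    have ij : (i < j)%N by rewrite ltn_neqAle eq_sym nji leqNgt.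
    rewrite kposU1 // 1?eq_sym // ij exprS mulN1r mulNr; congr (- _).
    rewrite setUCA koszul_htpyU1 => [|l]; last by case/setU1P => [->|/iS'].
    by rewrite least_div_sign least_divX.
  case/andP => _ ji.
  by rewrite least_div_sign least_divX0 ?mulr0.
rewrite eA2 [_ + B]addrC addrA subrK; congr (_ + _).
apply: eq_big => [j|j /andP[jS ji]].
  case: ltnP => ji; rewrite ?andbF // andbT in_setU1 negb_or ltn_ord_eqF //=.
  by apply/negP => /iS'; rewrite ltnNge ltnW.
rewrite kpos_min ?mul1r => [|l]; last first.
  by case/setU1P => [->|/iS' /(ltn_trans ji)]; apply: ltnW.
by rewrite koszul_htpyU1 // => l /setU1P[->|/iS' /(ltn_trans ji)].
Qed.

(** The homotopy identity fails only at [set0], by the constant term: the Koszul complex resolves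
    k. *)
Lemma koszul_exact w S : (forall T, koszul w T = 0) -> (w set0)@_0%MM = 0 ->
  koszul (koszul_htpy w) S = w S.
Proof.
move=> z w0; have [->|nS] := eqVneq S set0.
  by rewrite koszul_htpyE0 w0 mpolyC0 subr0.
rewrite -[RHS]koszul_htpyE // [X in _ + X](_ : _ = 0) ?addr0 //.
by rewrite /koszul_htpy big1 // => i _; rewrite z raddf0.
Qed.

Lemma koszulK w S : koszul (koszul w) S = 0.
Proof.
rewrite /koszul.
under eq_bigr => i iS do rewrite mulr_sumr mulr_sumr.
pose F i j := (-1) ^+ kpos i S * ('X_i * ((-1) ^+ kpos j (i |: S) *
  ('X_j * w (j |: (i |: S))))) : R.
rewrite (eq_bigr (fun i => \sum_(j | (j \notin S) && (i < j)%N) F i j +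
    \sum_(j | (j \notin S) && (j < i)%N) F i j)) => [|i iS]; last first.
  rewrite (bigID (fun j : 'I_m => (i < j)%N)) /=; congr (_ + _);
  apply: eq_bigl => j; rewrite in_setU1 negb_or -val_eqE /=; case: ltngtP;
  by rewrite ?andbF ?andbT.
rewrite big_split /=.
rewrite [X in _ + X](exchange_big_dep (fun j => j \notin S)) /=; last first.
  by move=> i j _ /andP[].
rewrite -big_split big1 //= => i iS.
rewrite [X in _ + X](eq_bigl (fun j => (j \notin S) && (i < j)%N)) => [|j]; last first.
  by rewrite iS.
rewrite -big_split big1 //= => j /andP[jS ij].
have nij : i != j by rewrite ltn_ord_eqF.
rewrite /F !kposU1 // 1?eq_sym // ij ltnNge ltnW //= add0n setUCA.
by rewrite exprS; ring.
Qed.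

End Koszul.

(** * Gradings on Koszul chains, and Koszul chains with values in free modules *)

Section Grading.
Variables (m : nat) (k : fieldType).
Notation R := {mpoly k[m]}.
Implicit Types (f g : R) (w : {set 'I_m} -> R) (S : {set 'I_m}).

Lemma mcoeff_filter (P : pred 'X_{1..m}) f mu :
  (\sum_(nu <- msupp f | P nu) f@_nu *: 'X_[nu])@_mu = f@_mu *+ P mu.
Proof.
rewrite raddf_sum /= big_mkcond /=.
have [in_f|nin] := boolP (mu \in msupp f); last first.
  rewrite memN_msupp_eq0 // mul0rn big_seq big1 // => nu nu_f.
  case: ifP => // _; rewrite mcoeffZ mcoeffX; case: eqP => [e|]; last by rewrite mulr0.
  by rewrite -e nu_f in nin.
rewrite (bigD1_seq _ in_f) ?msupp_uniq //= big1 => [|nu /negPf ne].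
  by rewrite addr0 mcoeffZ mcoeffX eqxx mulr1; case: ifP.
by rewrite mcoeffZ mcoeffX ne mulr0 if_same.
Qed.

Lemma mcoeff_pihomog d f mu : (pihomog mdeg d f)@_mu = f@_mu *+ (mdeg mu == d).
Proof. by rewrite pihomogE mcoeff_filter. Qed.

(* [homog_shift c t f] says that f is homogeneous of degree t - c, with the
   convention that f = 0 when t < c. *)
Definition homog_shift c t f := forall mu, (mdeg mu + c)%N != t -> f@_mu = 0.

(** The guard matters: for t < c the truncated difference is 0, and [pihomog] would return the
    constant term. *)
Definition part_shift c t f : R :=
  if (c <= t)%N then pihomog mdeg (t - c) f else 0.

Lemma mcoeff_part_shift c t f mu :
  (part_shift c t f)@_mu = f@_mu *+ (mdeg mu + c == t)%N.
Proof.
rewrite /part_shift; case: leqP => ct.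
  by rewrite mcoeff_pihomog -(eqn_add2r c) subnK.
by rewrite mcoeff0 gtn_eqF ?mulr0n // ltn_addl.
Qed.

Lemma part_shiftP c t f : homog_shift c t (part_shift c t f).
Proof. by move=> mu /negPf ne; rewrite mcoeff_part_shift ne. Qed.

Lemma part_shift_id c t f : homog_shift c t f -> part_shift c t f = f.
Proof.
move=> h; apply/mpolyP => mu; rewrite mcoeff_part_shift.
by case: eqVneq => [//|/h ->]; rewrite mul0rn.
Qed.

(** Multiplication by g raises degrees by a - b, so it carries the part of f of degree t - a to the
    part of the product of degree t - b. *)
Lemma mcoeff_part_shiftM b a t f g mu : homog_shift b a g ->
  (part_shift a t f * g)@_mu = (f * g)@_mu *+ (mdeg mu + b == t)%N.
Proof.
move=> hg; rewrite !mcoeffM -sumrMnl; apply: eq_bigr => -[m1 m2] /= /eqP e.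
have -> : (mdeg mu + b == t)%N = (mdeg m1 + (mdeg m2 + b) == t)%N.
  by rewrite addnA -mdegD -e.
rewrite mcoeff_part_shift.
have [<-|/hg ->] := eqVneq (mdeg m2 + b)%N a; last by rewrite !mulr0 mul0rn.
by rewrite mulrnAl.
Qed.

Lemma homog_shiftM b a t f g :
  homog_shift a t f -> homog_shift b a g -> homog_shift b t (f * g).
Proof.
move=> /part_shift_id <- hg mu /negPf ne.
by rewrite (mcoeff_part_shiftM _ _ _ hg) ne.
Qed.

Lemma homog_shift_sum (T : finType) (P : pred T) (F : T -> R) c t :
  (forall x, P x -> homog_shift c t (F x)) -> homog_shift c t (\sum_(x | P x) F x).
Proof.
by move=> h mu ne; rewrite raddf_sum big1 // => x Px; apply: h.
Qed.

Lemma homog_shift0 c t : homog_shift c t 0.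
Proof. by move=> mu _; rewrite mcoeff0. Qed.

(** Here e_S has degree [#|S|], so that the differential and the homotopy both preserve the total
    degree t; c is the degree of a generator of F. *)
Definition chain_homog c t w :=
  forall S, homog_shift (c + #|S|) t (w S).

Definition chain_level l w := forall S, #|S| != l -> w S = 0.

Lemma mcoeff_signM n f mu : ((-1) ^+ n * f)@_mu = (-1) ^+ n * f@_mu.
Proof.
rewrite -signr_odd -[in RHS]signr_odd; case: odd.
  by rewrite !expr1 !mulN1r mcoeffN.
by rewrite !expr0 !mul1r.
Qed.

Lemma koszul_homog c t w : chain_homog c t w -> chain_homog c t (koszul w).
Proof.
move=> h S; apply: homog_shift_sum => i iS mu ne.
rewrite mcoeff_signM mcoeffXM; case: eqP => [_|/eqP nz]; first by rewrite mulr0.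
rewrite h ?mul0rn ?mulr0 // cardsU1 iS; apply: contra ne => /eqP <-.
have le : (U_(i) <= mu)%MM by rewrite lep1mP.
have -> : mdeg mu = (mdeg (mu - U_(i))%MM).+1.
  by rewrite -{1}(submK le) mdegD mdeg1 addn1.
by apply/eqP; lia.
Qed.

Lemma koszul_htpy_homog c t w : chain_homog c t w -> chain_homog c t (koszul_htpy w).
Proof.
move=> h S; apply: homog_shift_sum => i /andP[iS _] mu ne.
rewrite mcoeff_least_div h ?mul0rn //; apply: contra ne => /eqP <-.
by rewrite mdegD mdeg1 (cardsD1 i S) iS; apply/eqP; lia.
Qed.

Lemma koszul_level l w : chain_level l.+1 w -> chain_level l (koszul w).
Proof.
move=> h S ne; rewrite /koszul big1 // => i iS.
by rewrite h ?mulr0 // cardsU1 iS add1n eqSS.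
Qed.

Lemma koszul_level0 w S : chain_level 0 w -> koszul w S = 0.
Proof.
move=> h; rewrite /koszul big1 // => i iS.
by rewrite h ?mulr0 // cardsU1 iS add1n.
Qed.

Lemma koszul_htpy_level l w : chain_level l w -> chain_level l.+1 (koszul_htpy w).
Proof.
move=> h S ne; rewrite /koszul_htpy big1 // => i /andP[iS _].
rewrite h ?raddf0 //; apply: contra ne => /eqP <-.
by rewrite (cardsD1 i S) iS.
Qed.

Lemma koszulD w w' S : koszul (fun T => w T + w' T) S = koszul w S + koszul w' S.
Proof. by rewrite -big_split; apply: eq_bigr => i _ /=; rewrite !mulrDr. Qed.

Lemma koszulMr w f S : koszul (fun T => w T * f) S = koszul w S * f.
Proof. by rewrite mulr_suml; apply: eq_bigr => i _ /=; rewrite !mulrA. Qed.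

Lemma koszulB w w' S : koszul (fun T => w T - w' T) S = koszul w S - koszul w' S.
Proof.
rewrite -sumrB; apply: eq_bigr => i _ /=; rewrite !mulrDr !mulrN //.
Qed.

Lemma koszul_sum (T : finType) (w : T -> {set 'I_m} -> R) S :
  koszul (fun S => \sum_x w x S) S = \sum_x koszul (w x) S.
Proof.
rewrite exchange_big; apply: eq_bigr => i _ /=.
by rewrite !mulr_sumr.
Qed.

Lemma mcoeff0_koszul w S : (koszul w S)@_0%MM = 0.
Proof.
rewrite raddf_sum big1 // => i _ /=.
by rewrite mcoeff_signM mcoeffXM mnm0E mulr0n mulr0.
Qed.

Section Vector.
Variable r : nat.
Implicit Types v : {set 'I_m} -> 'rV[R]_r.

Definition vkoszul v S : 'rV[R]_r := \row_a koszul (fun T => v T 0 a) S.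

Definition vkoszul_htpy v S : 'rV[R]_r := \row_a koszul_htpy (fun T => v T 0 a) S.

Lemma vkoszul_ext v v' S : (forall T, v T = v' T) -> vkoszul v S = vkoszul v' S.
Proof. by move=> e; apply/rowP => a; rewrite !mxE; apply: koszul_ext => T; rewrite e. Qed.

Lemma vkoszulM n (D : 'M[R]_(r, n)) v S b :
  koszul (fun T => (v T *m D) 0 b) S = (vkoszul v S *m D) 0 b.
Proof.
rewrite mxE (eq_bigr (fun a => koszul (fun T => v T 0 a * D a b) S)); last first.
  by move=> a _; rewrite mxE koszulMr.
by rewrite -koszul_sum; apply: koszul_ext => T; rewrite mxE.
Qed.

Lemma vkoszul_exact v S : (forall T, vkoszul v T = 0) ->
  (forall a, (v set0 0 a)@_0%MM = 0) -> vkoszul (vkoszul_htpy v) S = v S.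
Proof.
move=> z v0; apply/rowP => a; rewrite mxE.
rewrite (@koszul_ext _ _ _ (koszul_htpy (fun T => v T 0 a))) => [|T]; last by rewrite mxE.
by rewrite koszul_exact // => T; have /rowP/(_ a) := z T; rewrite !mxE.
Qed.

Lemma vkoszulK v S : vkoszul (vkoszul v) S = 0.
Proof.
apply/rowP => a; rewrite !mxE.
rewrite (@koszul_ext _ _ _ (koszul (fun T => v T 0 a))) => [|T]; last by rewrite mxE.
exact: koszulK.
Qed.

Lemma vkoszul_htpy0 v : vkoszul_htpy v set0 = 0.
Proof. by apply/rowP => a; rewrite !mxE koszul_htpy0. Qed.

Lemma vkoszulB v v' S :
  vkoszul (fun T => v T - v' T) S = vkoszul v S - vkoszul v' S.
Proof.
by apply/rowP => a; rewrite !mxE -koszulB; apply: koszul_ext => T; rewrite !mxE.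
Qed.

End Vector.

Lemma vkoszulMmx r n (D : 'M[R]_(r, n)) v S :
  vkoszul (fun T => v T *m D) S = vkoszul v S *m D.
Proof. by apply/rowP => b; rewrite mxE vkoszulM. Qed.

End Grading.

(** * Comparison of Koszul homology with a free resolution *)

Section IdealClosure.
Variables (R : comNzRingType) (I : {pred R}) (I_ideal : idealr_closed I).

Lemma ideal0 : 0 \in I. Proof. by case: I_ideal. Qed.

Lemma idealMl a u : u \in I -> a * u \in I.
Proof. by case: I_ideal => I0 _ h uI; rewrite -[_ * _]addr0; apply: h. Qed.

Lemma idealMr u a : u \in I -> u * a \in I.
Proof. by rewrite mulrC; apply: idealMl. Qed.

Lemma idealD u v : u \in I -> v \in I -> u + v \in I.
Proof. by case: I_ideal => _ _ h uI vI; rewrite -[u]mul1r; apply: h. Qed.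

Lemma idealN u : u \in I -> - u \in I.
Proof. by move=> uI; rewrite -mulN1r; apply: idealMl. Qed.

Lemma idealB u v : u \in I -> v \in I -> u - v \in I.
Proof. by move=> uI vI; apply/idealD/idealN. Qed.

Lemma ideal_sum (T : Type) (r : seq T) (P : pred T) (E : T -> R) :
  (forall x, P x -> E x \in I) -> \sum_(x <- r | P x) E x \in I.
Proof. by move=> h; elim/big_rec: _ => [|x u Px uI]; [exact: ideal0|apply/idealD; auto]. Qed.

Lemma idealBl u v : u - v \in I -> (u \in I) = (v \in I).
Proof.
move=> uvI; apply/idP/idP => h; last by rewrite -(subrK v u) idealD.
by rewrite -(subKr u v) idealB.
Qed.

End IdealClosure.

Section ZigZag.
Variables (m : nat) (k : fieldType).
Notation R := {mpoly k[m]}.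
Variables (I : {pred R}) (F : graded_resolution I).
Hypothesis I_ideal : idealr_closed I.
Hypothesis I_homog : forall f, f \in I -> forall d, pihomog mdeg d f \in I.
Hypothesis I_nondeg : forall f : R, f \is 1.-homog -> f \in I -> f = 0.
Implicit Types (S : {set 'I_m}) (om : {set 'I_m} -> R).
Notation rk := (res_rank F).
Notation d := (res_diff F).
Notation aug u := ((u *m res_aug F) ord0 ord0).

Lemma koszul_ideal om S : (forall T, om T \in I) -> koszul om S \in I.
Proof. by move=> h; apply: ideal_sum => // i _; do 2!apply: idealMl => //. Qed.

Definition vhomog r (deg : 'I_r -> nat) t (w : {set 'I_m} -> 'rV[R]_r) :=
  forall a, chain_homog (deg a) t (fun S => w S 0 a).

Definition vlevel r l (w : {set 'I_m} -> 'rV[R]_r) :=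
  forall S, #|S| != l -> w S = 0.

Lemma diff_homog p a b : homog_shift (res_deg (g := F) b) (res_deg (g := F) a) (d p a b).
Proof.
move=> mu ne; apply: memN_msupp_eq0; apply: contra ne => /res_diff_homog ->.
exact: eqxx.
Qed.

Lemma aug_homog a : homog_shift 0 (res_deg (g := F) a) (res_aug F a 0).
Proof.
move=> mu ne; apply: memN_msupp_eq0; apply: contra ne => /res_aug_homog ->.
by rewrite addn0.
Qed.

Lemma homog_shiftDr c n t (f : R) : homog_shift c t f -> homog_shift (c + n)%N (t + n)%N f.
Proof. by move=> h mu ne; apply: h; apply: contra ne => /eqP <-; apply/eqP; lia. Qed.

Lemma vhomogM r n (deg : 'I_r -> nat) (deg' : 'I_n -> nat) (D : 'M[R]_(r, n)) t w :
  (forall a b, homog_shift (deg' b) (deg a) (D a b)) ->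
  vhomog deg t w -> vhomog deg' t (fun S => w S *m D).
Proof.
move=> hD hw b S; rewrite mxE; apply: homog_shift_sum => a _.
exact: (homog_shiftM (hw a S) (homog_shiftDr (hD a b))).
Qed.

Lemma vhomog_htpy r (deg : 'I_r -> nat) t w :
  vhomog deg t w -> vhomog deg t (vkoszul_htpy w).
Proof. by move=> h a S; rewrite mxE; apply: koszul_htpy_homog. Qed.

Lemma vhomog_koszul r (deg : 'I_r -> nat) t w :
  vhomog deg t w -> vhomog deg t (vkoszul w).
Proof. by move=> h a S; rewrite mxE; apply: koszul_homog. Qed.

Lemma vlevel_entry r l w (a : 'I_r) : vlevel l w -> chain_level l (fun S => w S 0 a).
Proof. by move=> h S ne; rewrite h // mxE. Qed.

Lemma vlevel_htpy r l w : vlevel l w -> @vlevel r l.+1 (vkoszul_htpy w).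
Proof.
move=> h S ne; apply/rowP => a; rewrite !mxE.
exact: koszul_htpy_level (vlevel_entry _ h) _ ne.
Qed.

Lemma vlevel_koszul r l w : vlevel l.+1 w -> @vlevel r l (vkoszul w).
Proof.
move=> h S ne; apply/rowP => a; rewrite !mxE.
exact: koszul_level (vlevel_entry _ h) _ ne.
Qed.

Lemma vlevelM r n (D : 'M[R]_(r, n)) l w : vlevel l w -> vlevel l (fun S => w S *m D).
Proof. by move=> h S ne; rewrite h // mul0mx. Qed.

Lemma diffK p (u : 'rV_(rk p.+2)) : u *m d p.+1 *m d p = 0.
Proof. by apply/res_exact; exists u. Qed.

Lemma aug_diff (u : 'rV_(rk 1)) : aug (u *m d 0) \in I.
Proof. by apply/res_exact0; exists u. Qed.

Lemma koszul_aug (w : {set 'I_m} -> 'rV_(rk 0)) S :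
  koszul (fun T => aug (w T)) S = aug (vkoszul w S).
Proof. exact: vkoszulM. Qed.

Lemma augB (u v : 'rV_(rk 0)) : aug (u - v) = aug u - aug v.
Proof. by rewrite mulmxBl !mxE. Qed.

(* The zigzag of the double complex (Koszul complex) (x) F that computes Tor:
   w lives over F_p, om in the Koszul complex of R lifting that of R / I. *)
Fixpoint zigzag p : ({set 'I_m} -> 'rV[R]_(rk p)) -> ({set 'I_m} -> R) -> Prop :=
  match p with
  | 0 => fun w om => forall S, om S - aug (w S) \in I
  | p'.+1 => fun w om => exists w' : {set 'I_m} -> 'rV[R]_(rk p'),
      [/\ w' set0 = 0, forall S, vkoszul w' S = w S *m d p' & zigzag w' om]
  end.

Lemma zigzag_lin n p (w : 'I_n -> {set 'I_m} -> 'rV[R]_(rk p))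
    (om : 'I_n -> {set 'I_m} -> R) (c : 'I_n -> k) :
  (forall i, zigzag (w i) (om i)) ->
  zigzag (fun S => \sum_i (c i)%:MP *: w i S) (fun S => \sum_i (c i)%:MP * om i S).
Proof.
elim: p w => [|p IH] w h /=.
  move=> S; rewrite mulmx_suml summxE -sumrB; apply: ideal_sum => // i _.
  by rewrite -scalemxAl [X in _ - X]mxE -mulrBr; apply: idealMl => //; apply: h.
have /fin_all_exists[w' w'P] := h.
exists (fun S => \sum_i (c i)%:MP *: w' i S); split=> [|S|].
- by rewrite big1 // => i _; case: (w'P i) => -> _ _; rewrite scaler0.
- rewrite mulmx_suml; apply/rowP => a; rewrite mxE summxE.
  rewrite (@koszul_ext _ _ _ (fun T => \sum_i w' i T 0 a * (c i)%:MP)); last first.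
    by move=> T; rewrite summxE; apply: eq_bigr => i _; rewrite !mxE mulrC.
  rewrite koszul_sum; apply: eq_bigr => i _; rewrite koszulMr.
  case: (w'P i) => _ /(_ S)/rowP/(_ a); rewrite mxE => -> _.
  by rewrite -scalemxAl [in RHS]mxE mulrC.
- by apply: IH => i; case: (w'P i).
Qed.

(* From F to Koszul: lift along the contracting homotopy. *)
Lemma zigzag_lift p (w : {set 'I_m} -> 'rV[R]_(rk p)) l t :
  (if p is p'.+1 as p0 return ({set 'I_m} -> 'rV[R]_(rk p0)) -> Prop
   then fun w => (forall S, vkoszul w S *m d p' = 0) /\
          (forall a, ((w set0 *m d p') 0 a)@_0%MM = 0)
   else fun=> True) w ->
  vlevel l w -> vhomog (@res_deg _ _ _ F p) t w ->
  exists om, [/\ zigzag w om, chain_level (l + p)%N om & chain_homog 0 t om].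
Proof.
elim: p w l => [|p IH] w l.
  move=> _ lw hw; exists (fun S => aug (w S)); split=> [S|S|S].
  - by rewrite subrr ideal0.
  - by rewrite addn0 => ne; rewrite lw // mul0mx mxE.
  - rewrite mxE; apply: homog_shift_sum => a _.
    exact: (homog_shiftM (hw a S) (homog_shiftDr (@aug_homog a))).
case=> hk h0 lw hw; pose w' := vkoszul_htpy (fun S => w S *m d p).
have w'E S : vkoszul w' S = w S *m d p.
  by apply: vkoszul_exact => // T; rewrite vkoszulMmx hk.
have [||om [? ? ?]] := IH w' l.+1 _ (vlevel_htpy (vlevelM (d p) lw)).
- case: p {IH} w hk h0 hw lw @w' w'E => // p w hk h0 hw lw w' w'E.
  split=> [S|a]; first by rewrite w'E diffK.
  by rewrite /w' vkoszul_htpy0 mul0mx mxE mcoeff0.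
- by apply: vhomog_htpy; apply: vhomogM hw; apply: diff_homog.
exists om; split=> //; last by rewrite addnS -addSn.
by exists w'; split=> //; exact: vkoszul_htpy0.
Qed.

(** At the bottom of the staircase, the Koszul differential of om is congruent modulo I to the
    augmentation of an element in the image of [d 0]. *)
Lemma zigzag_ideal p w om S : @zigzag p.+1 w om -> koszul om S \in I.
Proof.
elim: p w => [|p IH] w /= [w' [_ kw' h]]; last exact: IH h.
have e T : koszul (fun T => om T - aug (w' T)) T \in I by apply: koszul_ideal.
move: (e S); rewrite koszulB koszul_aug kw' => /(idealBl I_ideal) ->.
exact: aug_diff.
Qed.

(** Injectivity of the comparison: a Koszul cycle om is the boundary of [koszul_htpy om]. This is
    lifted to F_0, and exactness of F carries the boundary up the staircase to w. *)
Lemma zigzag_inj p w om : @zigzag p w om -> (om set0)@_0%MM = 0 ->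
  (forall S, koszul om S = 0) ->
  exists (w' : {set 'I_m} -> 'rV[R]_(rk p)) (w'' : {set 'I_m} -> 'rV[R]_(rk p.+1)),
    forall S, w S = vkoszul w' S + w'' S *m d p.
Proof.
move=> h om0 kom; elim: p w h => [|p IH] w /= => [h|[w1 [_ kw1 /IH]]].
  have /fin_all_exists[u uP] S := res_aug_surj F (koszul_htpy om S).
  exists u; have /fin_all_exists[w'' w''P] S : exists v, w S - vkoszul u S = v *m d 0.
    have B : koszul (fun T => aug (u T) - koszul_htpy om T) S \in I by apply: koszul_ideal.
    apply/res_exact0; rewrite augB -koszul_aug.
    have -> : aug (w S) - koszul (fun T => aug (u T)) S =
        - ((om S - aug (w S)) + koszul (fun T => aug (u T) - koszul_htpy om T) S).
      by rewrite koszulB koszul_exact //; ring.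
    by apply: idealN => //; apply: idealD.
  by exists w'' => S; rewrite -w''P addrC subrK.
case=> w' [w'' e].
have /fin_all_exists[w3 w3P] S : exists v, w S - vkoszul w'' S = v *m d p.+1.
  apply/res_exact; rewrite mulmxBl -kw1 -vkoszulMmx.
  rewrite -(vkoszul_ext (v := fun T => w1 T - vkoszul w' T)
    (v' := fun T => w'' T *m d p)) => [|T]; last first.
    by rewrite e addrC addKr.
  by rewrite vkoszulB vkoszulK subr0 subrr.
by exists w'', w3 => S; rewrite -w3P addrC subrK.
Qed.

Lemma part_shift_ideal c t f : f \in I -> part_shift c t f \in I.
Proof. by rewrite /part_shift => fI; case: ifP => _; [apply: I_homog|apply: ideal0]. Qed.

Lemma part_shift_mulmx r n (deg : 'I_r -> nat) (deg' : 'I_n -> nat)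
    (D : 'M[R]_(r, n)) (u : 'rV_r) c t b :
  (forall a b, homog_shift (deg' b) (deg a) (D a b)) ->
  ((\row_a part_shift (deg a + c) t (u 0 a)) *m D) 0 b =
  part_shift (deg' b + c) t ((u *m D) 0 b).
Proof.
move=> hD; rewrite !mxE; apply/mpolyP => mu; rewrite mcoeff_part_shift !raddf_sum /=.
rewrite -sumrMnl; apply: eq_bigr => a _; rewrite !mxE.
by rewrite (mcoeff_part_shiftM (b := (deg' b + c)%N)) //; apply: homog_shiftDr.
Qed.

Lemma part_shift_rowP r (deg : 'I_r -> nat) c t (u : 'rV[R]_r) a :
  homog_shift (deg a + c) t ((\row_a part_shift (deg a + c) t (u 0 a)) 0 a).
Proof. by rewrite mxE; apply: part_shiftP. Qed.

(* From Koszul to F: lift along the exactness of F, degree by degree. *)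
Lemma zigzag_colift p l t om :
  chain_level (l + p)%N om -> chain_homog 0 t om -> (forall S, koszul om S \in I) ->
  exists w, [/\ @zigzag p w om, vlevel l w, vhomog (@res_deg _ _ _ F p) t w &
             forall S, exists v, vkoszul w S = v *m d p].
Proof.
move=> lom hom kom; elim: p l lom => [|p IH] l lom.
  have /fin_all_exists[u uP] S := res_aug_surj F (om S).
  (* The lifts u are arbitrary. Cutting them down to the right level and degree loses nothing, since
     om, I and the augmentation are graded. *)
  pose w S : 'rV_(rk 0) := if #|S| == l then
    \row_a part_shift (res_deg (g := F) a + #|S|) t (u S 0 a) else 0.
  have zw S : om S - aug (w S) \in I.
    rewrite /w; case: eqP => [eS|/eqP nS]; last first.
      by rewrite lom ?addn0 // mul0mx mxE subr0 ideal0.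
    rewrite (part_shift_mulmx (deg' := fun=> 0%N)); last first.
      by move=> a b; rewrite [b]ord1; apply: aug_homog.
    rewrite -(part_shift_id (hom S)) -opprB idealN //.
    rewrite (_ : _ - _ = part_shift (0 + #|S|) t (aug (u S) - om S)).
      exact: part_shift_ideal.
    by apply/mpolyP => mu; rewrite mcoeffB !mcoeff_part_shift mcoeffB mulrnBl.
  exists w; split=> //.
  - by move=> S nS; rewrite /w (negPf nS).
  - move=> a S; rewrite /w; case: ifP => _; first exact: part_shift_rowP.
    by rewrite mxE; apply: homog_shift0.
  - move=> S; apply/res_exact0; rewrite -koszul_aug.
    have : koszul (fun T => om T - aug (w T)) S \in I by apply: koszul_ideal.
    by rewrite koszulB => /(idealBl I_ideal) <-.
have [|w [zw lw hw /fin_all_exists[v vP]]] := IH l.+1; first by rewrite addSnnS.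
pose w1 S : 'rV_(rk p.+1) := if #|S| == l then
    \row_a part_shift (res_deg (g := F) a + #|S|) t (v S 0 a) else 0.
have w1E S : w1 S *m d p = vkoszul w S.
  rewrite /w1; case: eqP => [eS|/eqP nS]; last first.
    by rewrite mul0mx (vlevel_koszul lw).
  apply/rowP => b; rewrite (part_shift_mulmx _ _ _ _ (@diff_homog p)) -vP.
  by rewrite part_shift_id //; apply: (vhomog_koszul hw).
exists w1; split.
- by exists w; split=> //; rewrite lw // cards0.
- by move=> S nS; rewrite /w1 (negPf nS).
- move=> a S; rewrite /w1; case: ifP => _; first exact: part_shift_rowP.
  by rewrite mxE; apply: homog_shift0.
- move=> S; apply/res_exact; rewrite -vkoszulMmx.
  by rewrite (vkoszul_ext (v' := vkoszul w)) ?vkoszulK.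
Qed.

Lemma pihomog_koszul e om S :
  pihomog mdeg e.+1 (koszul om S) = koszul (fun T => pihomog mdeg e (om T)) S.
Proof.
rewrite raddf_sum; apply: eq_bigr => i _; apply/mpolyP => mu.
rewrite mcoeff_pihomog !mcoeff_signM !mcoeffXM.
case: eqP => [_|/eqP nz]; first by rewrite mulr0 mul0rn.
have le : (U_(i) <= mu)%MM by rewrite lep1mP.
rewrite -{2}(submK le) mdegD mdeg1 addn1 eqSS mcoeff_pihomog.
by rewrite !mulr1n mulrnAr.
Qed.

(** The comparison is well defined: a boundary w is pushed down the staircase, until om agrees
    modulo I with the differential of a chain of constants. Both are linear and I contains no linear
    forms, so they are equal and om is a cycle. *)
Lemma zigzag_boundary p w om w' (w'' : {set 'I_m} -> 'rV[R]_(rk p.+1)) :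
  @zigzag p w om -> (forall S, om S \is 1.-homog) ->
  (forall S, w S = vkoszul w' S + w'' S *m d p) -> w' set0 = 0 ->
  forall S, koszul om S = 0.
Proof.
move=> + hom; elim: p w w' w'' => [|p IH] w w' w'' h e w'0.
  (* As om is linear, only constants can contribute to it under the Koszul differential. *)
  pose th := fun T => pihomog mdeg 0 (aug (w' T)).
  have omE S : om S = koszul th S.
    apply/eqP; rewrite -subr_eq0; apply/eqP/I_nondeg.
      apply: rpredB; first exact: hom.
      rewrite (_ : koszul th S = pihomog mdeg 1 (koszul (fun T => aug (w' T)) S)).
        exact: pihomogP.
      by rewrite pihomog_koszul.
    rewrite -(pihomog_dE (hom S)) /th -pihomog_koszul -raddfB; apply: I_homog.
    rewrite koszul_aug.
    have -> : om S - aug (vkoszul w' S) = (om S - aug (w S)) + aug (w'' S *m d 0).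
      by rewrite e mulmxDl [X in _ - X + _]mxE; ring.
    by apply: idealD => //; apply: aug_diff.
  by move=> S; rewrite (koszul_ext _ omE) koszulK.
case: h => w1 [w10 kw1 /IH] IHw.
(* A Koszul cycle vanishing at [set0], hence a boundary: this writes w1 as a boundary one step
   lower. *)
pose u S := w1 S - w' S *m d p.
have ku S : vkoszul u S = 0.
  by rewrite vkoszulB vkoszulMmx kw1 e mulmxDl diffK addr0 subrr.
apply: (IHw (vkoszul_htpy u) w') => [S|]; last exact: vkoszul_htpy0.
rewrite vkoszul_exact ?subrK // => a.
by rewrite /u w10 w'0 mul0mx subr0 mxE mcoeff0.
Qed.

End ZigZag.

(** * Betti numbers as dimensions of spaces of linear syzygies *)

Definition free_family (k : fieldType) (M : lmodType k) n (x : 'I_n -> M) :=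
  forall c : 'I_n -> k, \sum_i c i *: x i = 0 -> forall i, c i = 0.

(** The spaces of syzygies are given by predicates and never get a basis; bounding the free families
    inside them suffices for comparing dimensions. *)
Definition dim_le (k : fieldType) (M : lmodType k) (P : M -> Prop) n :=
  forall r (x : 'I_r -> M), (forall i, P (x i)) -> free_family x -> (r <= n)%N.

Section Betti.
Variables (m : nat) (k : fieldType).
Notation R := {mpoly k[m]}.
Variables (I : {pred R}) (F : graded_resolution I).
Hypothesis I_ideal : idealr_closed I.
Hypothesis I_homog : forall f, f \in I -> forall d, pihomog mdeg d f \in I.
Hypothesis I_nondeg : forall f : R, f \is 1.-homog -> f \in I -> f = 0.
Notation rk := (res_rank F).
Notation d := (res_diff F).

(* For p = l + 1 this space is Tor_p(R/I, k)_(p+1), realized as the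
   linear syzygies in \wedge^(p-1) (x) I_2. *)
Definition linear_strand l (eta : {ffun {set 'I_m} -> R}) :=
  [/\ chain_level l eta, forall S, eta S \is 2.-homog, forall S, eta S \in I
    & forall S, koszul eta S = 0].

Lemma koszulMl (f : R) om S : koszul (fun T => f * om T) S = f * koszul om S.
Proof. by rewrite mulrC -koszulMr; apply: koszul_ext => T; rewrite mulrC. Qed.

Lemma koszul_comb n (c : 'I_n -> k) (om : 'I_n -> {set 'I_m} -> R) S :
  koszul (fun T => \sum_i (c i)%:MP * om i T) S = \sum_i c i *: koszul (om i) S.
Proof. by rewrite koszul_sum; apply: eq_bigr => i _; rewrite koszulMl mul_mpolyC. Qed.

Definition const_chain r (v : 'rV[k]_r) (S : {set 'I_m}) : 'rV[R]_r :=
  if S == set0 then map_mx (mpolyC m (R := k)) v else 0.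

Definition const_part r n (v : 'M[R]_(r, n)) : 'M[k]_(r, n) := map_mx (mcoeff 0%MM) v.

Lemma const_partK r (v : 'rV[k]_r) : const_part (const_chain v set0) = v.
Proof.
rewrite /const_chain eqxx; apply/rowP => a.
by rewrite !mxE mcoeffC eqxx mulr1.
Qed.

Lemma const_chain_level r (v : 'rV[k]_r) : vlevel 0 (const_chain v).
Proof. by move=> S; rewrite /const_chain cards_eq0 => /negPf ->. Qed.

Lemma vkoszul_level0 r (w : {set 'I_m} -> 'rV[R]_r) S : vlevel 0 w -> vkoszul w S = 0.
Proof.
move=> h; apply/rowP => a; rewrite !mxE; apply: koszul_level0.
exact: vlevel_entry h.
Qed.

Lemma const_part_vkoszul r (w : {set 'I_m} -> 'rV[R]_r) S : const_part (vkoszul w S) = 0.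
Proof. by apply/rowP => a; rewrite !mxE mcoeff0_koszul. Qed.

Lemma vkoszul_htpy_level0 r (w : {set 'I_m} -> 'rV[R]_r) S : vlevel 0 w ->
  const_part (w set0) = 0 -> vkoszul (vkoszul_htpy w) S = w S.
Proof.
move=> lw cw; apply: vkoszul_exact => [T|a]; first exact: vkoszul_level0.
by have /rowP/(_ a) := cw; rewrite !mxE.
Qed.

Lemma tor_pieceP p j (v : 'rV_(rk p)) :
  reflect (forall a, res_deg (g := F) a != j -> v 0 a = 0) (v <= tor_piece F p j)%MS.
Proof.
apply: (iffP submxP) => [[u ->] a /negPf ne|h].
  by rewrite mul_mx_diag !mxE ne mulr0.
exists v; apply/rowP => a; rewrite mul_mx_diag !mxE.
by case: eqVneq => [_|/h ->]; rewrite ?mulr1 ?mul0r.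
Qed.

Lemma tor_piece_id p j (v : 'rV_(rk p)) :
  (v <= tor_piece F p j)%MS -> v *m tor_piece F p j = v.
Proof.
move/tor_pieceP => h; apply/rowP => a; rewrite mul_mx_diag !mxE.
by case: eqVneq => [_|/h ->]; rewrite ?mulr1 ?mul0r.
Qed.

Lemma chain_homog_dhomog l t e om S : chain_homog 0 t om -> chain_level l om ->
  t = (e + l)%N -> om S \is (e.-homog : qualifier 0 R).
Proof.
move=> hom lom te; have [eS|nS] := eqVneq #|S| l; last by rewrite lom // dhomog0.
apply/dhomogP => mu; rewrite mcoeff_msupp => nz; apply/eqP.
apply: contraNT nz => ne; apply/eqP/hom; apply: contra ne.
by rewrite add0n eS te eqn_add2r.
Qed.

Lemma tor_cyclesP l j (v : 'rV_(rk l.+1)) : (v <= tor_cycles F l.+1 j)%MS =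
  (v <= tor_piece F l.+1 j)%MS && (v *m tor_diff F l == 0).
Proof. by rewrite /tor_cycles sub_capmx; congr (_ && _); apply/sub_kermxP/eqP. Qed.

(** A cycle of F (x) k is placed in \wedge^0. That it is killed by [tor_diff] says that its image
    under [d l] has no constant term, which is what the contracting homotopy requires. *)
Lemma zigzag_of_cycle l (v : 'rV_(rk l.+1)) : (v <= tor_cycles F l.+1 l.+2)%MS ->
  exists om, [/\ zigzag (p := l.+1) (const_chain v) om, chain_level l.+1 om
               & chain_homog 0 l.+2 om].
Proof.
rewrite tor_cyclesP => /andP[/tor_pieceP vp /eqP vd].
apply: (@zigzag_lift _ _ _ F I_ideal l.+1 _ 0).
- split=> [S|a]; first by rewrite vkoszul_level0 ?mul0mx //; apply: const_chain_level.
  have /rowP/(_ a) : const_part (const_chain v set0 *m d l) = 0.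
    by rewrite /const_part map_mxM /= -/(const_part _) const_partK vd.
  by rewrite !mxE.
- exact: const_chain_level.
- move=> a S mu; rewrite /const_chain; case: (S =P set0) => [->|_ _]; last by rewrite mxE mcoeff0.
  rewrite cards0 addn0 mxE mcoeffC => ne.
  have [mu0|] := eqVneq mu 0%MM; last by rewrite mulr0.
  by rewrite vp ?mul0r //; move: ne; rewrite mu0 mdeg0 add0n.
Qed.

Lemma mulmx_const r n (v : 'rV[k]_r) (D : 'M[R]_(r, n)) :
  const_part (const_chain v set0 *m D) = v *m const_part D.
Proof. by rewrite /const_part map_mxM /= -/(const_part _) const_partK. Qed.

(** Send a Tor class to [koszul om], with om at the end of its zigzag. If a combination maps to 0,
    then [zigzag_inj] writes its constant chain as a boundary of the double complex, and constant
    terms show that it bounds in F (x) k. *)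
Lemma betti_le_strand l n : dim_le (linear_strand l) n -> (betti F l.+1 1 <= n)%N.
Proof.
move=> dim_n; rewrite /betti addn1.
set C := tor_cycles F l.+1 l.+2; set B := tor_boundaries F l.+1 l.+2.
have BC : (B <= C)%MS by apply: tor_boundaries_cycles.
have rkD : \rank (C :\: B)%MS = (\rank C - \rank B)%N.
  by rewrite -(mxrank_cap_compl C B) (eqmxP (_ : C :&: B == B)%MS) ?addKn //;
     rewrite capmxSr sub_capmx BC submx_refl.
(* A complement of the boundaries in the cycles represents Tor, and V is a basis of it. *)
rewrite -rkD; set V := row_base (C :\: B)%MS.
have VC i : (row i V <= C)%MS.
  by rewrite (submx_trans (row_sub i V)) // eq_row_base diffmxSl.
have /fin_all_exists[om omP] i := zigzag_of_cycle (VC i).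
apply: (dim_n _ (fun i => [ffun S => koszul (om i) S])) => [i|c cz].
  case: (omP i) => zz lom hom; split.
  - by move=> S nS; rewrite ffunE (koszul_level lom).
  - move=> S; rewrite ffunE; apply: (@chain_homog_dhomog l l.+2).
    + exact: koszul_homog.
    + exact: koszul_level.
    + by rewrite add2n.
  - by move=> S; rewrite ffunE; apply: zigzag_ideal zz.
  - move=> S; rewrite (@koszul_ext _ _ _ (koszul (om i))) ?koszulK // => T.
    by rewrite ffunE.
have zz : forall i, zigzag (p := l.+1) (const_chain (row i V)) (om i).
  by move=> i; case: (omP i).
have {}zz := zigzag_lin I_ideal c zz.
pose v := \row_i c i *m V.
have vE : const_chain v =1 (fun S => \sum_i (c i)%:MP *: const_chain (row i V) S).
  move=> S; rewrite /const_chain; case: eqP => _; last first.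
    by rewrite big1 // => i _; rewrite scaler0.
  apply/rowP => a; rewrite /v mulmx_sum_row !mxE summxE !summxE rmorph_sum.
  by apply: eq_bigr => i _; rewrite !mxE rmorphM.
have om_lvl : (\sum_i (c i)%:MP * om i set0)@_0%MM = 0.
  rewrite big1 ?mcoeff0 // => i _; case: (omP i) => _ -> //; first by rewrite mulr0.
  by rewrite cards0.
have [S|w' [w'' e]] := zigzag_inj I_ideal zz om_lvl.
  rewrite koszul_comb; have /ffunP/(_ S) := cz.
  rewrite sum_ffunE !ffunE => E; rewrite -[RHS]E; apply: eq_bigr => i _.
  by rewrite !ffunE.
(* Koszul differentials have no constant term, so only w'' survives. *)
have vd : v = const_part (w'' set0) *m tor_diff F l.+1.
  rewrite -[LHS]const_partK vE e /const_part raddfD /= map_mxM.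
  by rewrite -/(const_part (vkoszul _ _)) const_part_vkoszul add0r.
have vV : (v <= C :\: B)%MS by rewrite (submx_trans (submxMl _ V)) // eq_row_base.
have vp : (v <= tor_piece F l.+1 l.+2)%MS.
  by move: (submx_trans vV (diffmxSl _ _)); rewrite tor_cyclesP => /andP[].
have vB : (v <= B)%MS.
  by rewrite -(tor_piece_id vp) vd -mulmxA -tor_diff_piece; exact: submxMl.
have : (v <= (C :\: B) :&: B)%MS by rewrite sub_capmx vB vV.
rewrite capmx_diff submx0 mulmx_free_eq0 ?row_base_free // => /eqP/rowP h i.
by have := h i; rewrite !mxE.
Qed.

(** The inverse construction: eta is the differential of [koszul_htpy eta], whose colift to F_(l+1)
    lies in \wedge^0 and has a Tor cycle as constant part. If a combination of these cycles bounds,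
    [zigzag_boundary] makes the same combination of the eta vanish. *)
Lemma strand_le_betti l : dim_le (linear_strand l) (betti F l.+1 1).
Proof.
move=> r eta etaP eta_free; rewrite /betti addn1.
set C := tor_cycles F l.+1 l.+2; set B := tor_boundaries F l.+1 l.+2.
have BC : (B <= C)%MS by apply: tor_boundaries_cycles.
pose om i := koszul_htpy (eta i).
have kom i S : koszul (om i) S = eta i S.
  case: (etaP i) => _ hom _ keta; apply: koszul_exact => //.
  by apply: (dhomog_nemf_coeff (hom set0)); rewrite /= mdeg0.
have om_lvl i : chain_level l.+1 (om i).
  by case: (etaP i) => lvl _ _ _; apply: koszul_htpy_level.
have om_hom i : chain_homog 0 l.+2 (om i).
  case: (etaP i) => lvl hom _ _; apply: koszul_htpy_homog => S mu.
  have [->|nS] := eqVneq #|S| l; last by rewrite lvl ?mcoeff0.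
  move=> ne; apply: (dhomog_nemf_coeff (hom S)); apply: contra ne => /eqP ->.
  by rewrite add0n add2n.
have /fin_all_exists[w wP] i : exists w, [/\ zigzag (p := l.+1) w (om i), vlevel 0 w &
    vhomog (@res_deg _ _ _ F l.+1) l.+2 w].
  have [|S|w [? ? ? _]] := zigzag_colift F I_ideal I_homog (l := 0) (p := l.+1) _ (om_hom i).
  - by rewrite add0n.
  - by rewrite kom; case: (etaP i).
  - by exists w.
pose V : 'M[k]_(r, rk l.+1) := \matrix_i const_part (w i set0).
have VC : (V <= C)%MS.
  apply/row_subP => i; rewrite rowK tor_cyclesP; case: (wP i) => zz lw hw.
  apply/andP; split.
    apply/tor_pieceP => a ne; rewrite mxE; apply: hw.
    by rewrite cards0 addn0 mdeg0 add0n.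
  case: zz => w1 [_ /(_ set0) e _].
  apply/eqP; rewrite -[LHS](map_mxM (mcoeff 0%MM)) -e.
  exact: const_part_vkoszul.
have V_free (c : 'rV_r) : (c *m V <= B)%MS -> c = 0.
  case/submxP => y0 cV; pose y := y0 *m tor_piece F l.+2 l.+2.
  have {}cV : c *m V = y *m tor_diff F l.+1 by rewrite cV mulmxA.
  have zz : forall i, zigzag (p := l.+1) (w i) (om i) by move=> i; case: (wP i).
  have {}zz := zigzag_lin I_ideal (c 0) zz.
  set ws := fun S => _ in zz; set oms := fun S => _ in zz.
  have ws_lvl : vlevel 0 ws.
    by move=> S nS; apply: big1 => i _; case: (wP i) => _ -> //; rewrite scaler0.
  have cws : const_part (ws set0) = c *m V.
    apply/rowP => a; rewrite mulmx_sum_row !mxE !summxE raddf_sum.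
    by apply: eq_bigr => i _; rewrite !mxE /= mcoeffCM.
  (* Of level 0 and without constant term, hence a Koszul boundary; so ws is a boundary of the
     double complex. *)
  pose u S := ws S - const_chain y S *m d l.+1.
  have u_lvl : vlevel 0 u.
    by move=> S nS; rewrite /u ws_lvl // const_chain_level // mul0mx subr0.
  have cu : const_part (u set0) = 0.
    have -> : const_part (u set0) =
        const_part (ws set0) - const_part (const_chain y set0 *m d l.+1).
      exact: map_mxB.
    by rewrite cws cV mulmx_const subrr.
  have koms : forall S, koszul oms S = 0.
    apply: (zigzag_boundary I_ideal I_homog I_nondeg zz _ (w' := vkoszul_htpy u)
      (w'' := const_chain y)).
    - move=> S; apply: rpred_sum => i _; rewrite mul_mpolyC dhomogZ //.
      exact: (chain_homog_dhomog S (om_hom i) (om_lvl i)).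
    - by move=> S; rewrite vkoszul_htpy_level0 // subrK.
    - exact: vkoszul_htpy0.
  apply/rowP => i; rewrite mxE; apply: (eta_free (c 0)).
  apply/ffunP => S; rewrite sum_ffunE !ffunE -[RHS](koms S) koszul_comb.
  by apply: eq_bigr => j _; rewrite ffunE kom.
have rV : \rank V = r.
  by apply/eqP/inj_row_free => c cV; apply: V_free; rewrite cV sub0mx.
rewrite leq_subRL ?mxrankS // -{1}rV addnC -mxrank_disjoint_sum.
  by rewrite mxrankS // addsmx_sub VC BC.
apply/eqP; rewrite -submx0; apply/row_subP => i; set x := row i _.
have : (x <= V :&: B)%MS by apply: row_sub.
rewrite sub_capmx => /andP[/submxP[c xc]]; rewrite xc => /V_free ->.
by rewrite mul0mx sub0mx.
Qed.

End Betti.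

(** * Dimension counts *)

Section DimLe.
Variable k : fieldType.

(** W need not be decidable: U is enlarged by excluded middle as long as some vector of W lies
    outside it, and its rank cannot exceed n. *)
Lemma subspace_mx n (W : 'rV[k]_n -> Prop) :
  W 0 -> (forall a u v, W u -> W v -> W (a *: u + v)) ->
  exists U : 'M[k]_n, forall v, (v <= U)%MS <-> W v.
Proof.
move=> W0 WD.
have WU (U : 'M[k]_n) : (forall i, W (row i U)) -> forall v, (v <= U)%MS -> W v.
  move=> rU v /submxP[c ->]; rewrite mulmx_sum_row.
  by elim/big_rec: _ => // i u _ Wu; apply: WD.
have [j] : exists j, (n < j)%N by exists n.+1.
suff: exists U : 'M[k]_n, (forall v, (v <= U)%MS -> W v) /\
    ((forall v, W v -> (v <= U)%MS) \/ (j <= \rank U)%N).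
  case=> U [UW [WU'|jU]] nj; first by exists U => v; split; [apply: UW|apply: WU'].
  by move: (leq_trans nj (leq_trans jU (rank_leq_row U))); rewrite ltnn.
elim: j => [|j [U [UW h]]].
  exists 0; split; last by right.
  by move=> v; rewrite submx0 => /eqP ->.
have [[v [Wv vU]]|nex] := classic (exists v, W v /\ ~~ (v <= U)%MS); last first.
  exists U; split=> //; left=> v Wv; apply/negPn/negP => vU.
  by apply: nex; exists v.
exists (U + v)%MS; split=> [x|].
  case/sub_addsmxP => -[a b] /= ->; rewrite -[_ *m U]scale1r; apply: (WD).
    by apply: UW; apply: submxMl.
  by rewrite [b]mx11_scalar mul_scalar_mx -[_ *: v]addr0; apply: WD.
case: h => [/(_ v Wv)|jU]; first by rewrite (negPf vU).
right; apply: leq_ltn_trans jU _; rewrite ltnNge; apply: contra vU => le.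
have : (U + v <= U)%MS by rewrite -(geq_leqif (mxrank_leqif_sup (addsmxSl U v))).
by rewrite addsmx_sub => /andP[].
Qed.

Lemma dim_le0 (M : lmodType k) (P : M -> Prop) : (forall x, P x -> x = 0) -> dim_le P 0.
Proof.
move=> P0 [//|r] x Px x_free; have := x_free (fun=> 1) _ ord0.
rewrite big1 => [/(_ erefl)/eqP|i _]; first by rewrite oner_eq0.
by rewrite (P0 _ (Px i)) scaler0.
Qed.

Lemma dim_le_leq (M : lmodType k) (P : M -> Prop) n n' :
  (n <= n')%N -> dim_le P n -> dim_le P n'.
Proof. by move=> nn Pn r x Px x_free; apply: leq_trans nn; apply: Pn Px x_free. Qed.

Lemma dim_le_ffun (T : finType) : dim_le (fun _ : {ffun T -> k^o} => True) #|T|.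
Proof.
move=> r x _ x_free; pose X := \matrix_(i < r, j < #|T|) (x i (enum_val j) : k).
have <- : \rank X = r; last exact: rank_leq_col.
apply/eqP/inj_row_free => c cX; apply/rowP => i; rewrite mxE.
apply: (x_free (c 0)); apply/ffunP => t; rewrite sum_ffunE !ffunE.
have /rowP/(_ (enum_rank t)) := cX; rewrite !mxE => E; rewrite -[RHS]E.
by apply: eq_bigr => j _; rewrite !ffunE mxE enum_rankK.
Qed.

(** Rank-nullity, carried out on the coefficient vectors of a free family: U consists of the
    combinations killed by f, and f stays injective on a complement of U. *)
Lemma dim_le_ker_im (M M' : lmodType k) (f : M -> M') (P : M -> Prop)
    (Q : M' -> Prop) n1 n2 : linear f ->
  P 0 -> (forall a u v, P u -> P v -> P (a *: u + v)) -> (forall x, P x -> Q (f x)) ->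
  dim_le (fun x => P x /\ f x = 0) n1 -> dim_le Q n2 -> dim_le P (n1 + n2).
Proof.
move=> f_lin P0 PD PQ dim1 dim2 r x Px x_free.
pose L : {linear M -> M'} := HB.pack f (GRing.isLinear.Build _ _ _ _ f f_lin).
have fE y : f y = L y by [].
pose comb (c : 'rV[k]_r) := \sum_i c 0 i *: x i.
have combE n (C : 'M_(n, r)) (b : 'I_n -> k) :
    \sum_j b j *: comb (row j C) = comb (\row_j b j *m C).
  rewrite /comb; under eq_bigr do rewrite scaler_sumr.
  rewrite exchange_big; apply: eq_bigr => i _; rewrite mxE scaler_suml.
  by apply: eq_bigr => j _; rewrite !mxE scalerA.
have combP c : P (comb c).
  by rewrite /comb; elim/big_rec: _ => // i u _ Pu; apply: PD.
have comb_inj c : comb c = 0 -> c = 0.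
  by move/x_free => h; apply/rowP => i; rewrite h mxE.
have combL a u v : comb (a *: u + v) = a *: comb u + comb v.
  rewrite /comb scaler_sumr -big_split; apply: eq_bigr => i _ /=.
  by rewrite !mxE scalerDl scalerA.
have [|a u v|U UP] := @subspace_mx r (fun c => f (comb c) = 0).
- by rewrite /comb big1 ?fE ?linear0 // => i _; rewrite mxE scale0r.
- by rewrite combL !fE linearP => -> ->; rewrite scaler0 addr0.
have rU : (\rank U <= n1)%N.
  apply: (dim1 _ (fun j => comb (row j (row_base U)))) => [j|b].
    split=> //; apply/UP; rewrite (submx_trans (row_sub _ _)) //.
    by rewrite eq_row_base.
  rewrite combE => /comb_inj/eqP; rewrite mulmx_free_eq0 ?row_base_free //.
  by move=> /eqP/rowP h j; have := h j; rewrite !mxE.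
have rUC : (\rank U^C <= n2)%N.
  apply: (dim2 _ (fun j => f (comb (row j (row_base U^C%MS))))) => [j|b].
    exact: PQ.
  have -> : \sum_j b j *: f (comb (row j (row_base U^C%MS))) =
      f (comb (\row_j b j *m row_base U^C%MS)).
    by rewrite -combE fE raddf_sum; apply: eq_bigr => j _; rewrite [RHS](linearZ_LR L).
  move/UP; set y := _ *m _ => yU.
  have yUC : (y <= U^C)%MS by rewrite (submx_trans (submxMl _ _)) // eq_row_base.
  have : (y <= U :&: U^C)%MS by rewrite sub_capmx yU.
  rewrite capmx_compl submx0 mulmx_free_eq0 ?row_base_free //.
  by move=> /eqP/rowP h j; have := h j; rewrite !mxE.
apply: leq_trans (leq_add rU rUC).
by rewrite mxrank_compl subnKC // rank_leq_row.
Qed.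

End DimLe.

(** * The syzygies of the projection *)

Lemma comp_mpoly_homog (k : fieldType) n m (lq : n.-tuple {mpoly k[m]}) d (f : {mpoly k[n]}) :
  (forall i, tnth lq i \is 1.-homog) -> f \is d.-homog -> f \mPo lq \is d.-homog.
Proof.
move=> lq1 fd; rewrite comp_mpolyE big_seq; apply: rpred_sum => mu mu_f.
rewrite dhomogZ // -(dhomog_mf fd mu_f) /= mdegE.
elim/big_rec2: _ => [|i d' g _ hg]; first exact: dhomog1.
by apply: dhomogM => //; have := dhomogMn (mu i) (lq1 i); rewrite mul1n.
Qed.

Lemma comp_mpoly_pihomog (k : fieldType) n m (lq : n.-tuple {mpoly k[m]}) d (f : {mpoly k[n]}) :
  (forall i, tnth lq i \is 1.-homog) -> pihomog mdeg d (f \mPo lq) = pihomog mdeg d f \mPo lq.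
Proof.
move=> lq1; apply/mpolyP => mu; rewrite mcoeff_pihomog.
rewrite {1}(pihomog_partitionE (leqnn (msize f))) [_ \mPo lq]raddf_sum raddf_sum /=.
have hom e := comp_mpoly_homog lq1 (pihomogP mdeg e f).
have [mud|ne] := eqVneq (mdeg mu) d; last first.
  by rewrite mulr0n (dhomog_nemf_coeff (hom d)).
rewrite mulr1n; case: (ltnP d (msize f)) => df.
  rewrite (bigD1 (Ordinal df)) //= big1 ?addr0 // => e /= ne.
  apply: (dhomog_nemf_coeff (hom e)); rewrite /= mud; apply: contra ne => /eqP de.
  by apply/eqP/val_inj.
have -> : pihomog mdeg d f = 0.
  apply/mpolyP => nu; rewrite mcoeff_pihomog mcoeff0; case: eqP => [nud|_]; last by rewrite mulr0n.
  by rewrite memN_msupp_eq0 ?mul0rn // msize_mdeg_ge // nud.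
rewrite comp_mpoly0 mcoeff0 big1 // => e _; apply: (dhomog_nemf_coeff (hom e)).
by rewrite /= mud gtn_eqF // (leq_trans (ltn_ord e)).
Qed.

Section Restriction.
Variables (k : fieldType) (N : nat).
Notation R := {mpoly k[N.+1]}.
Notation S := {mpoly k[N]}.
Implicit Types (f : R) (h : S).

Definition drop_X0 : R -> S :=
  comp_mpoly [tuple (if unlift ord0 i is Some j then 'X_j else 0) | i < N.+1].

HB.instance Definition _ := GRing.RMorphism.on drop_X0.
HB.instance Definition _ := GRing.Linear.on drop_X0.
HB.instance Definition _ := GRing.RMorphism.copy (@S_incl k N)
   (comp_mpoly [tuple 'X_(lift ord0 i) | i < N]).
HB.instance Definition _ := GRing.Linear.copy (@S_incl k N)
   (comp_mpoly [tuple 'X_(lift ord0 i) | i < N]).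

Lemma drop_X0_X0 : drop_X0 'X_ord0 = 0.
Proof. by rewrite /drop_X0 comp_mpolyXU -tnth_nth tnth_mktuple unlift_none. Qed.

Lemma drop_X0_lift i : drop_X0 'X_(lift ord0 i) = 'X_i.
Proof. by rewrite /drop_X0 comp_mpolyXU -tnth_nth tnth_mktuple liftK. Qed.

Lemma S_inclX i : S_incl 'X_i = 'X_(lift ord0 i) :> R.
Proof. by rewrite /S_incl comp_mpolyXU -tnth_nth tnth_mktuple. Qed.

Lemma drop_X0_homog d f : f \is d.-homog -> drop_X0 f \is d.-homog.
Proof.
apply: comp_mpoly_homog => i; rewrite tnth_mktuple; case: unlift => [j|].
  by rewrite dhomogX /= mdeg1.
exact: dhomog0.
Qed.

Lemma S_incl_homog d h : h \is d.-homog -> S_incl h \is d.-homog.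
Proof. by apply: comp_mpoly_homog => i; rewrite tnth_mktuple dhomogX /= mdeg1. Qed.

Lemma S_inclK : cancel (@S_incl k N) drop_X0.
Proof.
move=> h; rewrite {1}(mpolyE h) [RHS]mpolyE [S_incl _]raddf_sum [drop_X0 _]raddf_sum /=.
apply: eq_bigr => mu _.
rewrite !linearZ /= mpolyXE_id !rmorph_prod /=; congr (_ *: _).
by apply: eq_bigr => i _; rewrite !rmorphXn /= S_inclX drop_X0_lift.
Qed.

Lemma drop_X0K f : (forall mu : 'X_{1..N.+1}, mu ord0 != 0%N -> f@_mu = 0) ->
  S_incl (drop_X0 f) = f.
Proof.
move=> f0; rewrite {1}(mpolyE f) [RHS]mpolyE [drop_X0 _]raddf_sum [S_incl _]raddf_sum /= !big_seq.
apply: eq_bigr => mu; rewrite mcoeff_msupp => nz.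
have mu0 : mu ord0 = 0%N by apply/eqP; apply: contraNT nz => /f0 ->.
rewrite !linearZ /= mpolyXE_id !rmorph_prod /= !big_ord_recl mu0 !expr0 !rmorph1.
congr (_ *: (_ * _)); apply: eq_bigr => i _.
by rewrite !rmorphXn /= drop_X0_lift S_inclX.
Qed.

End Restriction.

(* A combinatorial form of the equality of \wedge^(l+1) L, for a linear subspace
   L of W, with the kernel of \wedge^l W (x) L -> \wedge^(l-1) W (x) Sym^2 W;
   Pv is a set of pivots of L. *)
Lemma pivot_vanish (T : finType) (V : nmodType) (zeta : {set T} -> T -> V)
    (Pv : {set T}) l :
  (forall S : {set T}, #|S| != l -> forall i, zeta S i = 0) ->
  (forall (S : {set T}) i, i \in S -> zeta S i = 0) ->
  (forall (B : {set T}) i j, i \in B -> j \in B -> zeta (B :\ i) i = 0 -> zeta (B :\ j) j = 0) ->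
  (forall S, (forall i, i \in Pv -> zeta S i = 0) -> forall i, zeta S i = 0) ->
  (forall B : {set T}, B \subset Pv -> #|B| = l.+1 ->
     exists2 b, b \in B & zeta (B :\ b) b = 0) ->
  forall S i, zeta S i = 0.
Proof.
move=> zl zin zsym zpiv zB.
(* Induction on the number of elements of B outside Pv. For such an element j, [zsym] moves the
   distinguished index to j and [zpiv] reduces to pivots a; then [a |: (B :\ j)] has one nonpivot
   fewer. *)
suff key n : forall B : {set T}, #|B :\: Pv| = n -> #|B| = l.+1 ->
    forall i, i \in B -> zeta (B :\ i) i = 0.
  move=> S i; have [iS|iS] := boolP (i \in S); first exact: zin.
  have [cS|nS] := eqVneq #|S| l; last exact: zl.
  rewrite -(setU1K iS); apply: (key #|(i |: S) :\: Pv|) => //; last exact: setU11.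
  by rewrite cardsU1 iS cS.
elim: n => [|n IH] B cB sB i iB.
  have BP : B \subset Pv by rewrite -setD_eq0 -cards_eq0 cB.
  have [b bB zb] := zB B BP sB.
  exact: (zsym B b).
have /card_gt0P[j] : (0 < #|B :\: Pv|)%N by rewrite cB.
rewrite inE => /andP[jP jB].
apply: (zsym B j) => //; apply: zpiv => a aP.
have [aB|aB] := boolP (a \in B :\ j); first exact: zin.
rewrite -{1}(setU1K aB); apply: IH; last exact: setU11.
- move: cB; rewrite (cardsD1 j) inE jP jB add1n => -[<-].
  apply: eq_card => x; rewrite !inE; case: (eqVneq x a) => [->|_] /=.
    by rewrite aP andbF.
  by case: (x \in Pv); case: (x == j).
- by rewrite cardsU1 aB -sB [in RHS](cardsD1 j) jB.
Qed.

Section StrandProjection.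
Variables (k : fieldType) (N : nat).
Notation R := {mpoly k[N.+1]}.
Notation S := {mpoly k[N]}.
Variable I : {pred R}.
Hypothesis I_ideal : idealr_closed I.
Hypothesis I_homog : forall f, f \in I -> forall d, pihomog mdeg d f \in I.
Definition section_ideal : {pred S} := [pred h | S_incl h \in I].
Notation J := section_ideal.
Notation X0X0 := (U_(ord0) + U_(ord0))%MM.
Notation X0X i := (U_(ord0) + U_(lift ord0 i))%MM.
Hypothesis I_point : forall f : R, f \in I -> f@_X0X0 = 0.
Implicit Types (T : {set 'I_N}) (i j : 'I_N) (eta : {ffun {set 'I_N.+1} -> R}).

Definition up T := [set lift ord0 i | i in T].

Lemma mem_up i T : (lift ord0 i \in up T) = (i \in T).
Proof. by rewrite mem_imset //; apply: lift_inj. Qed.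

Lemma ord0_up T : ord0 \in up T = false.
Proof. by apply/imsetP => -[i _ /eqP]; rewrite -val_eqE. Qed.

Lemma upU1 i T : up (i |: T) = lift ord0 i |: up T.
Proof. by rewrite /up imsetU1. Qed.

Lemma card_up T : #|up T| = #|T|.
Proof. by rewrite card_imset //; apply: lift_inj. Qed.

Lemma set_up (B : {set 'I_N.+1}) : exists T, B = up T \/ B = ord0 |: up T.
Proof.
exists [set i | lift ord0 i \in B].
have [B0|B0] := boolP (ord0 \in B); [right|left]; apply/setP => j;
  rewrite ?in_setU1; case: (unliftP ord0 j) => [i ->|->];
  rewrite ?mem_up ?inE ?ord0_up ?eqxx ?B0 ?(negPf B0) //.
Qed.

Lemma kpos_up i T : kpos (lift ord0 i) (up T) = kpos i T.
Proof.
rewrite /kpos -(card_up [set j in T | _]); apply: eq_card => x; rewrite !inE.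
case: (unliftP ord0 x) => [j ->|->]; last by rewrite !ord0_up.
by rewrite !mem_up !inE.
Qed.

Lemma koszul_up (w : {set 'I_N.+1} -> R) T :
  koszul w (up T) = 'X_ord0 * w (ord0 |: up T) +
    \sum_(i | i \notin T) (-1) ^+ kpos i T * ('X_(lift ord0 i) * w (up (i |: T))).
Proof.
rewrite /koszul big_mkcond big_ord_recl ord0_up /=; congr (_ + _).
  by rewrite kpos_min ?mul1r // => j _; apply: leq0n.
rewrite [RHS]big_mkcond; apply: eq_bigr => i _.
by rewrite mem_up kpos_up upU1.
Qed.

Lemma koszul_U1_up (w : {set 'I_N.+1} -> R) T :
  koszul w (ord0 |: up T) =
    - \sum_(i | i \notin T)
        (-1) ^+ kpos i T * ('X_(lift ord0 i) * w (ord0 |: up (i |: T))).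
Proof.
rewrite /koszul big_mkcond big_ord_recl setU11 /= add0r -sumrN [RHS]big_mkcond.
apply: eq_bigr => i _; rewrite in_setU1 mem_up /=; case: (i \in T) => //=.
rewrite kposU1 ?ord0_up // kpos_up exprS mulN1r mulNr upU1.
by rewrite setUCA.
Qed.

Lemma mcoeff_X0_2 f (mu : 'X_{1..N.+1}) : f \in I -> f \is 2.-homog -> (1 < mu ord0)%N -> f@_mu = 0.
Proof.
move=> fI f2 mu0; have [mu2|ne] := eqVneq (mdeg mu) 2; last exact: (dhomog_nemf_coeff f2).
suff -> : mu = X0X0 by apply: I_point.
move: mu2; rewrite mdegE big_ord_recl => mu2.
apply/mnmP => j; rewrite mnmDE mnm1E; case: (unliftP ord0 j) => [i ->|->].
  have : (mu (lift ord0 i) <= \sum_(j < N) mu (lift ord0 j))%N.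
    by rewrite (bigD1 i) //= leq_addr.
  have -> : (ord0 == lift ord0 i) = false by [].
  by move: mu2 mu0; rewrite addn0 /=; lia.
by rewrite eqxx; lia.
Qed.

(** In the syzygy at [up T], only ['X_ord0 * eta (ord0 |: up T)] can contribute monomials divisible
    by x_0^2: the other terms are some x_i, i > 0, times quadrics of I, which have no x_0^2. *)
Lemma strand_U1_up l eta T : linear_strand I l eta ->
  S_incl (drop_X0 (eta (ord0 |: up T))) = eta (ord0 |: up T).
Proof.
case=> _ hom etaI keta; apply: drop_X0K => mu mu0.
have /(congr1 (mcoeff (U_(ord0) + mu)%MM)) := keta (up T).
rewrite koszul_up mcoeff0 mcoeffD mcoeffXM mnmDE mnm1E eqxx /=.
rewrite addmC addmK mulr1n raddf_sum big1 ?addr0 // => i _.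
rewrite /= mcoeff_signM mcoeffXM mcoeff_X0_2 ?mul0rn ?mulr0 //.
by rewrite mnmBE mnmDE !mnm1E eqxx /= subn0 addn1 ltnS lt0n.
Qed.

Definition contract eta : {ffun {set 'I_N} -> S} :=
  [ffun T => drop_X0 (eta (ord0 |: up T))].

Lemma contract_linear : linear contract.
Proof. by move=> a u v; apply/ffunP => T; rewrite !ffunE linearP. Qed.

Lemma contract_strand l eta : linear_strand I l.+1 eta -> linear_strand J l (contract eta).
Proof.
move=> sl; case: (sl) => lvl hom etaI keta; split=> T.
- by move=> nT; rewrite ffunE lvl ?raddf0 // cardsU1 ord0_up card_up add1n eqSS.
- by rewrite ffunE; apply: drop_X0_homog.
- by rewrite inE ffunE (strand_U1_up _ sl).
- have /(congr1 (fun f => drop_X0 (- f))) := keta (ord0 |: up T).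
  rewrite koszul_U1_up opprK oppr0 raddf0 => E; rewrite -[RHS]E raddf_sum.
  apply: eq_bigr => i _ /=; rewrite rmorphM rmorphXn rmorphN1 rmorphM /= drop_X0_lift.
  by rewrite ffunE.
Qed.

Lemma contract_eq0 l eta T : linear_strand I l eta -> contract eta = 0 ->
  eta (ord0 |: up T) = 0.
Proof.
move=> sl /ffunP/(_ T); rewrite !ffunE => E.
by rewrite -(strand_U1_up _ sl) E raddf0.
Qed.

Definition x0_part eta T i := (eta (up T))@_(X0X i).

(** For a = b only the first branch applies, so that x_a^2 is not counted twice. *)
Lemma mcoeffXM_pair i (f : R) a b :
  ('X_(lift ord0 i) * f)@_(U_(ord0) + (U_(lift ord0 a) + U_(lift ord0 b))) =
  if i == a then f@_(X0X b) else if i == b then f@_(X0X a) else 0.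
Proof.
have ne0 : (ord0 == lift ord0 i) = false by [].
have inj := inj_eq (@lift_inj _ (ord0 : 'I_N.+1)).
rewrite mcoeffXM !mnmDE !mnm1E ne0 !inj add0n ![_ == i]eq_sym.
case: (eqVneq i a) => [->|ia] /=.
  by rewrite mulr1n [(U_(lift ord0 a) + _)%MM]addmC addmA addmK.
case: (eqVneq i b) => [->|ib] /=; last by rewrite mulr0n.
by rewrite mulr1n addmA addmK.
Qed.

(** The coefficients of x_0 x_a x_b, once beta = 0, express that [x0_part] is a cycle: its
    differential vanishes in \wedge W (x) Sym^2 W. *)
Lemma koszul_up_coeff l eta T a b : linear_strand I l eta -> contract eta = 0 ->
  \sum_(i | i \notin T) (-1) ^+ kpos i T *
    (if i == a then x0_part eta (i |: T) b
     else if i == b then x0_part eta (i |: T) a else 0) = 0.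
Proof.
move=> sl c0; case: (sl) => _ _ _ /(_ (up T)).
rewrite koszul_up (contract_eq0 _ sl c0) mulr0 add0r.
move=> /(congr1 (mcoeff (U_(ord0) + (U_(lift ord0 a) + U_(lift ord0 b))))).
rewrite mcoeff0 raddf_sum => E; rewrite -[RHS]E; apply: eq_bigr => i _ /=.
by rewrite mcoeff_signM mcoeffXM_pair.
Qed.

Lemma sign_mul_eq0 n (x : k) : (-1) ^+ n * x = 0 -> x = 0.
Proof. by move/eqP; rewrite mulf_eq0 signr_eq0 => /eqP. Qed.

(** In the coefficient of x_0 x_i^2 at [T :\ i] a single term survives. *)
Lemma x0_part_in l eta T i : linear_strand I l eta -> contract eta = 0 -> i \in T ->
  x0_part eta T i = 0.
Proof.
move=> sl c0 iT; have := koszul_up_coeff (T :\ i) i i sl c0.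
rewrite (bigD1 i) ?setD11 //= eqxx setD1K // big1 ?addr0 => [/sign_mul_eq0 //|j].
by case/andP => _ /negPf ->; rewrite mulr0.
Qed.

(** The coefficient of x_0 x_i x_j at B without i and j has two terms, which are the two values up
    to sign. *)
Lemma x0_part_sym l eta (B : {set 'I_N}) i j : linear_strand I l eta ->
  contract eta = 0 -> i \in B -> j \in B ->
  x0_part eta (B :\ i) i = 0 -> x0_part eta (B :\ j) j = 0.
Proof.
move=> sl c0 iB jB zi; have [->//|ij] := eqVneq j i.
have := koszul_up_coeff (B :\ i :\ j) i j sl c0.
rewrite (bigD1 i) ?inE ?eqxx ?andbF //= (bigD1 j) ?inE ?eqxx ?ij //=.
rewrite (negPf ij) setD1K ?inE ?ij // zi mulr0 add0r.
have -> : i |: (B :\ i) :\ j = B :\ j.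
  apply/setP => x; rewrite !inE; case: (eqVneq x i) => [->|//] /=.
  by rewrite eq_sym ij iB.
rewrite big1 ?addr0 => [/sign_mul_eq0 //|x /andP[/andP[_ /negPf ->] /negPf ->]].
by rewrite mulr0.
Qed.

Lemma strand_up l eta T : linear_strand I l eta -> (forall i, x0_part eta T i = 0) ->
  S_incl (drop_X0 (eta (up T))) = eta (up T).
Proof.
case=> _ hom etaI _ z; apply: drop_X0K => mu mu0.
have [mu1|] := ltnP 1 (mu ord0); first exact: mcoeff_X0_2.
rewrite leq_eqVlt ltnS leqn0 (negPf mu0) orbF => /eqP mu1.
have [mu2|ne] := eqVneq (mdeg mu) 2; last exact: (dhomog_nemf_coeff (hom _)).
have le : (U_(ord0) <= mu)%MM by rewrite lep1mP.
have /mdeg1P[j /eqP ej] : mdeg (mu - U_(ord0))%MM == 1%N.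
  by have := congr1 (@mdeg _) (submK le); rewrite mdegD mdeg1 mu2 addn1 => -[->].
move: mu1; rewrite -(submK le) ej.
case: (unliftP ord0 j) => [i ->|->].
  by move=> _; rewrite addmC; apply: z.
by rewrite mnmDE !mnm1E eqxx.
Qed.

Variable Pv : {set 'I_N}.
Hypothesis Pv_pivots : forall f : R, f \in I -> f \is 2.-homog ->
  (forall i, i \in Pv -> f@_(X0X i) = 0) -> forall i, f@_(X0X i) = 0.

Local Notation pivot_sets l := {B : {set 'I_N} | (B \subset Pv) && (#|B| == l.+1)}.

(** Coordinates on \wedge^(l+1) L, one for each (l+1)-subset B of the pivots. By [x0_part_sym] the
    vanishing of the value does not depend on the b picked; B is nonempty, so the default 0 is never
    reached. *)
Definition pivot_part l eta : {ffun pivot_sets l -> k^o} :=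
  [ffun B : pivot_sets l =>
     (if [pick b in sval B] is Some b then x0_part eta (sval B :\ b) b else 0) : k^o].

Lemma pivot_part_linear l : linear (@pivot_part l).
Proof.
move=> a u v; apply/ffunP => B; rewrite !ffunE; case: pickP => [b _|_].
  by rewrite /x0_part !ffunE mcoeffD mcoeffZ.
by rewrite scaler0 addr0.
Qed.

Lemma pivot_part_eq0 l eta T i : linear_strand I l eta -> contract eta = 0 ->
  pivot_part l eta = 0 -> x0_part eta T i = 0.
Proof.
move=> sl c0 p0; apply: (@pivot_vanish _ _ (x0_part eta) Pv l).
- move=> B nB j; case: sl => lvl _ _ _.
  by rewrite /x0_part lvl ?card_up // mcoeff0.
- by move=> B j; apply: x0_part_in sl c0.
- by move=> B a b; apply: x0_part_sym sl c0.
- by move=> B hB; case: sl => _ hom etaI _; apply: Pv_pivots.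
- move=> B BP /eqP cB; have PB : (B \subset Pv) && (#|B| == l.+1) by rewrite BP.
  have /ffunP/(_ (exist _ B PB)) := p0; rewrite !ffunE /=.
  case: pickP => [b bB E|/(_ _)B0 _]; first by exists b.
  by move: cB; rewrite (eq_card0 B0).
Qed.

Definition restrict eta : {ffun {set 'I_N} -> S} := [ffun T => drop_X0 (eta (up T))].

Lemma restrict_linear : linear restrict.
Proof. by move=> a u v; apply/ffunP => T; rewrite !ffunE linearP. Qed.

Lemma restrict_strand l eta : linear_strand I l eta -> contract eta = 0 ->
  pivot_part l eta = 0 -> linear_strand J l (restrict eta).
Proof.
move=> sl c0 p0; case: (sl) => lvl hom etaI keta; split=> T.
- by move=> nT; rewrite ffunE lvl ?raddf0 // card_up.
- by rewrite ffunE; apply: drop_X0_homog.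
- rewrite inE ffunE (strand_up sl) // => i; exact: pivot_part_eq0 sl c0 p0.
- have /(congr1 (@drop_X0 k N)) := keta (up T).
  rewrite koszul_up (contract_eq0 _ sl c0) mulr0 add0r raddf0 => E.
  rewrite -[RHS]E raddf_sum; apply: eq_bigr => i _ /=.
  by rewrite rmorphM rmorphXn rmorphN1 rmorphM /= drop_X0_lift ffunE.
Qed.

Lemma linear_strand_comb l a eta eta' : linear_strand I l eta -> linear_strand I l eta' ->
  linear_strand I l (a *: eta + eta').
Proof.
case=> lvl hom etaI keta [lvl' hom' etaI' keta']; split=> B.
- by move=> nB; rewrite !ffunE lvl // lvl' // scaler0 addr0.
- by rewrite !ffunE rpredD ?rpredZ.
- by rewrite !ffunE -mul_mpolyC; apply: idealD => //; apply: idealMl.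
- rewrite (koszul_ext (w' := fun B => a%:MP * eta B + eta' B)) => [|C].
    by rewrite koszulD koszulMl keta keta' mulr0 addr0.
  by rewrite !ffunE mul_mpolyC.
Qed.

Lemma linear_strand0 l : linear_strand I l 0.
Proof.
split=> B.
- by rewrite ffunE.
- by rewrite ffunE; apply: dhomog0.
- by rewrite ffunE ideal0.
- by rewrite /koszul big1 // => i _; rewrite ffunE !mulr0.
Qed.

(** Rank-nullity is applied along [contract], then [pivot_part] on its kernel, then [restrict] on
    what remains; a strand killed by all three is 0. *)
Theorem strand_projection_le l n n' :
  (forall l', l = l'.+1 -> dim_le (linear_strand J l') n') ->
  dim_le (linear_strand J l) n ->
  dim_le (linear_strand I l) (n' + ('C(#|Pv|, l.+1) + n)).
Proof.
move=> dim_n' dim_n.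
(* For l = 0 there is no strand one step lower: a chain of level 0 has no component containing
   [ord0], so its contraction is 0. *)
pose Q (eta' : {ffun {set 'I_N} -> S}) :=
  if l is l'.+1 then linear_strand J l' eta' else eta' = 0.
rewrite addnC; apply: (dim_le_ker_im (f := contract) (Q := Q) contract_linear).
- exact: linear_strand0.
- by move=> *; apply: linear_strand_comb.
- move=> eta; rewrite /Q; case: (l) => [[lvl _ _ _]|l']; last exact: contract_strand.
  by apply/ffunP => T; rewrite !ffunE lvl ?raddf0 // cardsU1 ord0_up.
- rewrite addnC; apply: (dim_le_ker_im (f := @pivot_part l) (Q := fun=> True)
    (@pivot_part_linear l)).
  + split; first exact: linear_strand0.
    by apply/ffunP => T; rewrite !ffunE raddf0.
  + move=> a u v [su cu] [sv cv]; split; first exact: linear_strand_comb.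
    by rewrite contract_linear cu cv scaler0 addr0.
  + by [].
  + rewrite -[n]add0n; apply: (dim_le_ker_im restrict_linear _ _ _ _ dim_n).
    * split; [split; first exact: linear_strand0 |]; apply/ffunP => T; rewrite !ffunE.
        by rewrite raddf0.
      by case: pickP => // b _; rewrite /x0_part ffunE mcoeff0.
    * move=> a u v [[su cu] pu] [[sv cv] pv]; split; [split|].
      - exact: linear_strand_comb.
      - by rewrite contract_linear cu cv scaler0 addr0.
      - by rewrite pivot_part_linear pu pv scaler0 addr0.
    * by move=> eta [[sl c0] p0]; apply: restrict_strand.
    * apply: dim_le0 => eta [[[sl c0] p0] r0]; apply/ffunP => B; rewrite ffunE.
      have [T [->|->]] := set_up B; last exact: contract_eq0 sl c0.
      rewrite -(strand_up sl) => [|i]; last exact: pivot_part_eq0 sl c0 p0.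
      by have /ffunP/(_ T) := r0; rewrite !ffunE => ->; rewrite raddf0.
  + have <- : #|{: pivot_sets l}| = 'C(#|Pv|, l.+1).
      by rewrite card_sig -cards_draws cardsE.
    exact: dim_le_ffun.
- rewrite /Q; case: (l) dim_n' => [_|l' h]; last exact: h.
  by apply: (dim_le_leq (leq0n _)); apply: dim_le0.
Qed.

End StrandProjection.

(** * Changes of coordinates *)

Section LinearSubstitution.
Variables (k : fieldType) (N : nat).
Notation R := {mpoly k[N.+1]}.
Implicit Types (A B : 'M[k]_N.+1) (f : R).

HB.instance Definition _ A := GRing.RMorphism.copy (lin_subst A)
  (comp_mpoly [tuple \sum_j A i j *: ('X_j : R) | i < N.+1]).
HB.instance Definition _ A := GRing.Linear.copy (lin_subst A)
  (comp_mpoly [tuple \sum_j A i j *: ('X_j : R) | i < N.+1]).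

Lemma lin_substX A i : lin_subst A 'X_i = \sum_j A i j *: 'X_j.
Proof. by rewrite /lin_subst comp_mpolyXU -tnth_nth tnth_mktuple. Qed.

Lemma lin_subst_homog A d f : f \is d.-homog -> lin_subst A f \is d.-homog.
Proof.
apply: comp_mpoly_homog => i; rewrite tnth_mktuple; apply: rpred_sum => j _.
by rewrite dhomogZ // dhomogX /= mdeg1.
Qed.

Lemma lin_substE A f :
  lin_subst A f = \sum_(mu <- msupp f) f@_mu *: \prod_i (lin_subst A 'X_i) ^+ mu i.
Proof.
rewrite {1}(mpolyE f) [lin_subst _ _]raddf_sum /=; apply: eq_bigr => mu _.
rewrite linearZ /= mpolyXE_id [lin_subst _ _]rmorph_prod /=; congr (_ *: _).
by apply: eq_bigr => i _; rewrite rmorphXn.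
Qed.

Lemma lin_subst1 f : lin_subst 1%:M f = f.
Proof.
rewrite lin_substE [RHS]mpolyE; apply: eq_bigr => mu _; rewrite [in RHS]mpolyXE_id.
congr (_ *: _); apply: eq_bigr => i _; rewrite lin_substX (bigD1 i) //= mxE eqxx scale1r.
by rewrite big1 ?addr0 // => j /negPf ne; rewrite mxE eq_sym ne scale0r.
Qed.

Lemma lin_substMX A B i : lin_subst B (lin_subst A 'X_i) = lin_subst (A *m B) 'X_i.
Proof.
rewrite !lin_substX [lin_subst _ _]raddf_sum /=.
under eq_bigr do rewrite linearZ /= lin_substX scaler_sumr.
rewrite exchange_big; apply: eq_bigr => l _ /=.
by rewrite mxE scaler_suml; apply: eq_bigr => j _; rewrite scalerA.
Qed.

Lemma lin_substM A B f : lin_subst B (lin_subst A f) = lin_subst (A *m B) f.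
Proof.
rewrite [lin_subst A f]lin_substE [RHS]lin_substE [lin_subst B _]raddf_sum /=.
apply: eq_bigr => mu _; rewrite linearZ /= [lin_subst _ _]rmorph_prod /=; congr (_ *: _).
by apply: eq_bigr => i _; rewrite -lin_substMX rmorphXn.
Qed.

Lemma lin_substVK A f : A \in unitmx -> lin_subst A (lin_subst (invmx A) f) = f.
Proof. by move=> uA; rewrite lin_substM mulVmx // lin_subst1. Qed.

Lemma lin_substK A f : A \in unitmx -> lin_subst (invmx A) (lin_subst A f) = f.
Proof. by move=> uA; rewrite lin_substM mulmxV // lin_subst1. Qed.

Lemma homog_shift_dhomog c t f : (c <= t)%N -> homog_shift c t f <-> f \is (t - c).-homog.
Proof.
move=> ct; split=> [h|/dhomog_nemf_coeff h mu ne].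
  apply/dhomogP => mu; rewrite mcoeff_msupp => nz; apply/eqP; apply: contraNT nz => ne.
  by apply/eqP/h; apply: contra ne => /eqP <-; rewrite addnK.
by apply: h; apply: contra ne => /eqP /= ->; rewrite subnK.
Qed.

Lemma homog_shift_lt c t f : (t < c)%N -> homog_shift c t f -> f = 0.
Proof.
by move=> tc h; apply/mpolyP => mu; rewrite mcoeff0 h // gtn_eqF // ltn_addl.
Qed.

Lemma lin_subst_shift A c t f : homog_shift c t f -> homog_shift c t (lin_subst A f).
Proof.
case: (leqP c t) => [ct|tc].
  by rewrite !homog_shift_dhomog //; apply: lin_subst_homog.
by move=> h; rewrite (homog_shift_lt tc h) raddf0; apply: homog_shift0.
Qed.

Lemma lin_subst_const A f : (lin_subst A f)@_0%MM = f@_0%MM.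
Proof.
rewrite lin_substE raddf_sum /=.
have E mu : (f@_mu *: \prod_i lin_subst A 'X_i ^+ mu i)@_0%MM = f@_mu *+ (mu == 0%MM).
  rewrite mcoeffZ; case: eqP => [->|/eqP nz].
    rewrite big1 ?mcoeff1 ?eqxx ?mulr1 // => i _; by rewrite mnm0E.
  have : \prod_i (lin_subst A 'X_i) ^+ mu i \is (mdeg mu).-homog.
    have -> : \prod_i (lin_subst A 'X_i) ^+ mu i = lin_subst A 'X_[mu].
      rewrite [in RHS]mpolyXE_id [RHS]rmorph_prod; apply: eq_bigr => i _.
      by rewrite /= rmorphXn.
    by apply: lin_subst_homog; rewrite dhomogX /=.
  move/dhomog_nemf_coeff => -> /=; first by rewrite mulr0.
  by rewrite mdeg0 eq_sym mdeg_eq0.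
rewrite (eq_bigr _ (fun mu _ => E mu)) [in RHS](mpolyE f) raddf_sum.
by apply: eq_bigr => mu _; rewrite /= mcoeffZ mcoeffX mulr_natr.
Qed.

Lemma lin_subst_pihomog B d f : pihomog mdeg d (lin_subst B f) = lin_subst B (pihomog mdeg d f).
Proof.
apply: comp_mpoly_pihomog => i; rewrite tnth_mktuple; apply: rpred_sum => j _.
by rewrite dhomogZ // dhomogX /= mdeg1.
Qed.

End LinearSubstitution.

Section CoordinateChange.
Variables (k : fieldType) (N : nat).
Notation R := {mpoly k[N.+1]}.
Variables (A : 'M[k]_N.+1) (A_unit : A \in unitmx) (I : {pred R}).
Notation I' := (coord_change A I).
Notation subst := (lin_subst A).
Notation subst' := (lin_subst (invmx A)).

Let substK m n (D : 'M[R]_(m, n)) : map_mx subst' (map_mx subst D) = D.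
Proof. by apply/matrixP => i j; rewrite !mxE lin_substK. Qed.

Let substVK m n (D : 'M[R]_(m, n)) : map_mx subst (map_mx subst' D) = D.
Proof. by apply/matrixP => i j; rewrite !mxE lin_substVK. Qed.

Lemma coord_changeE f : (f \in I') = (subst' f \in I).
Proof. by []. Qed.

Lemma coord_change_ideal : idealr_closed I -> idealr_closed I'.
Proof.
case=> I0 I1 ID; split; rewrite ?inE ?raddf0 ?rmorph1 //.
by move=> a u v uI vI; rewrite inE rmorphD rmorphM; apply: ID.
Qed.

Variable F : graded_resolution I.

Let substM m n p (D : 'M[R]_(m, n)) (E : 'M_(n, p)) :
  map_mx subst (D *m E) = map_mx subst D *m map_mx subst E.
Proof. exact: map_mxM. Qed.

Let subst'M m n p (D : 'M[R]_(m, n)) (E : 'M_(n, p)) :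
  map_mx subst' (D *m E) = map_mx subst' D *m map_mx subst' E.
Proof. exact: map_mxM. Qed.

Lemma coord_change_aug (u : 'rV[R]_(res_rank F 0)) :
  subst' ((u *m map_mx subst (res_aug F)) ord0 ord0) =
  (map_mx subst' u *m res_aug F) ord0 ord0.
Proof.
by rewrite -[in RHS](substK (res_aug F)) -subst'M [RHS]mxE.
Qed.

Lemma coord_change_exact (a b c : nat) (D : 'M[R]_(a, b)) (E : 'M[R]_(b, c)) (u : 'rV_b) :
  (forall u : 'rV_b, u *m E = 0 <-> exists v, u = v *m D) ->
  u *m map_mx subst E = 0 <-> exists v, u = v *m map_mx subst D.
Proof.
move=> ex; split=> [uE|[v ->]].
  have [v uv] : exists v, map_mx subst' u = v *m D.
    by apply/ex; rewrite -[E]substK -subst'M uE map_mx0.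
  by exists (map_mx subst v); rewrite -substM -uv substVK.
rewrite -[v]substVK -!substM (_ : map_mx subst' v *m D *m E = 0) ?map_mx0 //.
by apply/ex; exists (map_mx subst' v).
Qed.

(** The matrices of F are substituted entrywise. A linear substitution preserves degrees and
    constant terms, so F (x) k does not change. *)
Lemma coord_change_resolution : exists F' : graded_resolution I',
  forall p q, betti F' p q = betti F p q.
Proof.
have diffH i a b mon : mon \in msupp (map_mx subst (res_diff F i) a b) ->
    (mdeg mon + res_deg (g := F) b)%N = res_deg (g := F) a.
  rewrite mxE => mon_in; apply/eqP; apply: contraLR mon_in => ne.
  by rewrite -mcoeff_eq0; apply/eqP; apply: (lin_subst_shift A (@diff_homog _ _ _ F i a b)).
have augH a mon : mon \in msupp (map_mx subst (res_aug F) a ord0) ->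
    mdeg mon = res_deg (g := F) a.
  rewrite mxE => mon_in; apply/eqP; apply: contraLR mon_in => ne.
  rewrite -mcoeff_eq0; apply/eqP; apply: (lin_subst_shift A (@aug_homog _ _ _ F a)).
  by rewrite addn0.
have augS f : exists u : 'rV[R]_(res_rank F 0),
    (u *m map_mx subst (res_aug F)) ord0 ord0 - f \in I'.
  have [u uP] := res_aug_surj F (subst' f).
  exists (map_mx subst u); rewrite coord_changeE rmorphB /= coord_change_aug substK.
  exact: uP.
have ex0 (u : 'rV[R]_(res_rank F 0)) :
    (u *m map_mx subst (res_aug F)) ord0 ord0 \in I' <->
    exists v, u = v *m map_mx subst (res_diff F 0).
  rewrite coord_changeE coord_change_aug; split=> [/res_exact0[v uv]|[v ->]].
    by exists (map_mx subst v); rewrite -substM -uv substVK.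
  by apply/res_exact0; exists (map_mx subst' v); rewrite subst'M substK.
have exS i u := @coord_change_exact _ _ _ (res_diff F i.+1) (res_diff F i) u (@res_exact _ _ _ F i).
exists (GradedResolution diffH augH augS ex0 exS) => p q.
set F' := GradedResolution _ _ _ _ _.
have tdE i : tor_diff F' i = tor_diff F i.
  by apply/matrixP => a b; rewrite !mxE /= lin_subst_const.
by case: p => [|p]; rewrite /betti /tor_cycles /tor_boundaries ?tdE.
Qed.

End CoordinateChange.

(** * Ideals in the new coordinates, and pivots of the space L *)

Section TransferredIdeals.
Variables (k : fieldType) (N : nat).
Notation R := {mpoly k[N.+1]}.
Implicit Type I : {pred R}.

Lemma coord_change_homogeneous A I :
  homogeneous_ideal I -> homogeneous_ideal (coord_change A I).
Proof.
case=> I_ideal I_homog; split; first exact: coord_change_ideal.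
move=> f; rewrite !coord_changeE => fI d.
by rewrite coord_changeE -lin_subst_pihomog; apply: I_homog.
Qed.

Lemma coord_change_prime A I :
  prime_idealr_closed I -> prime_idealr_closed (coord_change A I).
Proof. by move=> pI u v; rewrite !coord_changeE rmorphM /=; apply: pI. Qed.

Lemma coord_change_nondegenerate A I : A \in unitmx ->
  nondegenerate_ideal I -> nondegenerate_ideal (coord_change A I).
Proof.
move=> uA nI f f1 fI; rewrite -(lin_substVK f uA) (nI _ _ fI) ?raddf0 //.
exact: lin_subst_homog.
Qed.

Definition base_point (i : 'I_N.+1) : k := (i == ord0)%:R.

Lemma meval_lin_subst A (f : R) v :
  (lin_subst A f).@[v] = f.@[fun i => \sum_j A i j * v j].
Proof.
rewrite /lin_subst comp_mpoly_meval; apply: meval_eq => i.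
rewrite tnth_mktuple raddf_sum; apply: eq_bigr => j _.
by rewrite /= mevalZ mevalXU.
Qed.

Lemma coord_change_base_point A I (q : 'cV[k]_N.+1) : A \in unitmx -> col ord0 A = q ->
  on_variety I q -> forall f, f \in coord_change A I -> f.@[base_point] = 0.
Proof.
move=> uA Aq [_ qI] f fI; rewrite -(qI _ fI) meval_lin_subst; apply: meval_eq => i.
rewrite -Aq -[RHS](_ : (invmx A *m A) i ord0 = _).
  by rewrite mulVmx // mxE /base_point.
by rewrite mxE; apply: eq_bigr => j _; rewrite !mxE.
Qed.

Lemma meval_base_point d (f : R) : f \is d.-homog ->
  f.@[base_point] = f@_(U_(ord0) *+ d)%MM.
Proof.
move=> fd; rewrite mevalE [in RHS](mpolyE f) raddf_sum !big_seq.
apply: eq_bigr => mu mu_f; rewrite /= mcoeffZ mcoeffX; congr (_ * _).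
have mud : mdeg mu = d := dhomog_mf fd mu_f.
rewrite big_ord_recl /base_point eqxx expr1n mul1r.
case: eqP => [->|ne].
  by rewrite big1 // => i _; rewrite mulmnE mnm1E /= mul0n.
have [i nz] : exists i, mu (lift ord0 i) != 0%N.
  apply/existsP; apply: contra_notT ne => /existsPn z.
  have z' i : mu (lift ord0 i) = 0%N by apply/eqP; rewrite -[_ == _]negbK z.
  apply/mnmP => j; rewrite mulmnE mnm1E; case: (unliftP ord0 j) => [i ->|->].
    by rewrite z' /= mul0n.
  by rewrite eqxx mul1n -mud mdegE big_ord_recl big1 ?addn0.
by rewrite (bigD1 i) //= expr0n (negPf nz) mul0r.
Qed.

Lemma base_point_X0X0 I : (forall f, f \in I -> f.@[base_point] = 0) ->
  (forall f, f \in I -> forall d, pihomog mdeg d f \in I) ->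
  forall f, f \in I -> f@_(U_(ord0) + U_(ord0)) = 0.
Proof.
move=> vI hI f fI; have := vI _ (hI _ fI 2).
rewrite (meval_base_point (pihomogP mdeg 2 f)) mcoeff_pihomog mdegMn mdeg1 mulr1n.
by rewrite mulmS mulm1n.
Qed.

Lemma section_ideal_closed I : idealr_closed I -> idealr_closed (section_ideal I).
Proof.
case=> I0 I1 ID; split; rewrite ?inE ?raddf0 ?rmorph1 //.
by move=> a u v uI vI; rewrite inE rmorphD rmorphM; apply: ID.
Qed.

Lemma section_ideal_homog I : (forall f, f \in I -> forall d, pihomog mdeg d f \in I) ->
  forall f, f \in section_ideal I -> forall d, pihomog mdeg d f \in section_ideal I.
Proof.
move=> hI f fI d; rewrite inE /S_incl -comp_mpoly_pihomog; first exact: hI.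
by move=> i; rewrite tnth_mktuple dhomogX /= mdeg1.
Qed.

Lemma section_ideal_nondegenerate I : (forall f : R, f \is 1.-homog -> f \in I -> f = 0) ->
  forall f : {mpoly k[N]}, f \is 1.-homog -> f \in section_ideal I -> f = 0.
Proof.
move=> nI f f1 fI; rewrite -(S_inclK f) (nI _ _ fI) ?raddf0 //.
exact: S_incl_homog.
Qed.

(** A reduced basis of L, the space of the vectors [lin f]: t independent columns of a basis are the
    pivots, and the rows are lifted to quadrics of I. *)
Lemma exists_pivots I : idealr_closed I ->
  exists t (pv : 'I_t -> 'I_N) (fs : 'I_t -> R),
  [/\ forall j, fs j \in I, forall j, fs j \is 2.-homog,
      forall i j, (fs j)@_(U_(ord0) + U_(lift ord0 (pv i))) = (i == j)%:R &
      forall f, f \in I -> f \is 2.-homog ->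
        (forall i, f@_(U_(ord0) + U_(lift ord0 (pv i))) = 0) ->
        forall i, f@_(U_(ord0) + U_(lift ord0 i)) = 0].
Proof.
move=> I_ideal.
pose lin (f : R) : 'rV[k]_N := \row_i f@_(U_(ord0) + U_(lift ord0 i)).
have linD a f g : lin (a *: f + g) = a *: lin f + lin g.
  by apply/rowP => i; rewrite !mxE mcoeffD mcoeffZ.
have [||U UP] := @subspace_mx k N (fun v => exists f : R, [/\ f \in I, f \is 2.-homog & v = lin f]).
- exists 0; split; [exact: ideal0|exact: dhomog0|].
  by apply/rowP => i; rewrite !mxE mcoeff0.
- move=> a u v [f [fI f2 ->]] [g [gI g2 ->]]; exists (a *: f + g); split=> //.
    by rewrite -mul_mpolyC; apply: idealD => //; apply: idealMl.
  by rewrite rpredD ?rpredZ.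
set t := \rank U; pose M := row_base U.
have Mfull : row_full M^T by rewrite /row_full mxrank_tr eq_row_base.
pose pv := fullrankfun Mfull.
pose P := rowsub pv M^T.
have uP : P \in unitmx by apply: fullrowsub_unit.
(* Normalized so that the pivot columns form the identity matrix. *)
pose M' := invmx P^T *m M.
have uPT : P^T \in unitmx by rewrite unitmx_tr.
have M'U : (M' :=: U)%MS.
  apply: eqmx_trans (eq_row_base U); apply: eqmxMfull.
  by rewrite row_full_unit unitmx_inv.
have M'pv j i : M' j (pv i) = (i == j)%:R.
  have -> : M' j (pv i) = (invmx P^T *m P^T) j i.
    by rewrite !mxE; apply: eq_bigr => l _; rewrite !mxE.
  by rewrite mulVmx // mxE eq_sym.
have /fin_all_exists[fs fsP] j : exists f : R, [/\ f \in I, f \is 2.-homog & row j M' = lin f].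
  by apply/UP; rewrite (submx_trans (row_sub _ _)) // M'U.
exists t, pv, fs; split.
- by move=> j; case: (fsP j).
- by move=> j; case: (fsP j).
- move=> i j; case: (fsP j) => _ _ /rowP/(_ (pv i)).
  by rewrite [LHS]mxE [RHS]mxE M'pv.
- move=> f fI f2 f0 i.
  have /submxP[c fc] : (lin f <= M')%MS by rewrite M'U; apply/UP; exists f.
  have c0 : c = 0.
    apply/rowP => j; have /rowP/(_ (pv j)) := fc; rewrite [LHS]mxE [RHS]mxE f0.
    rewrite (bigD1 j) //= M'pv eqxx mulr1 big1 ?addr0 => [<-|l /negPf ne].
      by rewrite mxE.
    by rewrite M'pv eq_sym ne mulr0.
  by have /rowP/(_ i) := fc; rewrite c0 mul0mx !mxE.
Qed.

End TransferredIdeals.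

Theorem inner_projection_betti (k : fieldType) N (I : {pred {mpoly k[N.+1]}})
    (Pv : {set 'I_N}) (F : graded_resolution I) (G : graded_resolution (section_ideal I)) p :
  homogeneous_ideal I -> nondegenerate_ideal I ->
  (forall f, f \in I -> f.@[@base_point k N] = 0) ->
  (forall f, f \in I -> f \is 2.-homog ->
        (forall i, i \in Pv -> f@_(U_(ord0) + U_(lift ord0 i)) = 0) ->
        forall i, f@_(U_(ord0) + U_(lift ord0 i)) = 0) ->
  (1 <= p)%N -> (betti F p 1 <= betti G p 1 + betti G p.-1 1 + 'C(#|Pv|, p))%N.
Proof.
move=> [I_ideal I_homog] I_nondeg I_pt Pv_piv; case: p => // l _ /=.
have J_ideal := section_ideal_closed I_ideal.
have J_homog := section_ideal_homog I_homog.
have J_nondeg := section_ideal_nondegenerate I_nondeg.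
have X00 := base_point_X0X0 I_pt I_homog.
rewrite addnAC addnC [(_ + 'C(_, _))%N]addnC.
apply: (@betti_le_strand _ _ I F I_ideal).
apply: (strand_projection_le I_ideal X00 Pv_piv).
  by move=> l' ->; apply: strand_le_betti.
exact: strand_le_betti.
Qed.

(** * Algebraic independence modulo a prime ideal *)

Definition alg_indep (k : fieldType) m (P : {pred {mpoly k[m]}}) r
    (u : r.-tuple {mpoly k[m]}) :=
  forall G : {mpoly k[r]}, G \mPo u \in P -> G = 0.

Section Chains.
Variable k : fieldType.

(** No variable precedes x_0, so [least_div ord0] divides by x_0 every monomial containing it. *)
Lemma X0_decomp N (G : {mpoly k[N.+1]}) :
  G = S_incl (drop_X0 G) + 'X_ord0 * least_div ord0 G.
Proof.
have below mu : vanish_below (ord0 : 'I_N.+1) mu by apply/forallP.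
have -> : drop_X0 G = drop_X0 (G - 'X_ord0 * least_div ord0 G).
  by rewrite rmorphB rmorphM /= drop_X0_X0 mul0r subr0.
rewrite drop_X0K ?subrK // => mu mu0.
by rewrite mcoeffB mcoeff_XM_least_div below mu0 subrr.
Qed.

Lemma comp_S_incl N m (f : {mpoly k[m]}) (u : N.-tuple {mpoly k[m]}) (h : {mpoly k[N]}) :
  S_incl h \mPo [tuple of f :: u] = h \mPo u.
Proof.
rewrite {1}(mpolyE h) [RHS]comp_mpolyE [S_incl _]raddf_sum [_ \mPo _]raddf_sum /=.
apply: eq_bigr => mu _; rewrite !linearZ /= mpolyXE_id; congr (_ *: _).
rewrite [S_incl _]rmorph_prod [_ \mPo _]rmorph_prod /=; apply: eq_bigr => i _.
rewrite [S_incl _]rmorphXn /= S_inclX rmorphXn /= comp_mpolyXU; congr (_ ^+ _).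
by rewrite /= (tnth_nth 0).
Qed.

(** Modulo Q, where f vanishes, a relation G of [f :: u] becomes a relation of u alone, so G has no
    term free of X_0. As f is not in the prime P, the factor X_0 can be cancelled, and the size of G
    drops. *)
Lemma alg_indep_cons m (P Q : {pred {mpoly k[m]}}) r (u : r.-tuple {mpoly k[m]}) f :
  idealr_closed P -> prime_idealr_closed P -> idealr_closed Q -> {subset P <= Q} ->
  f \in Q -> f \notin P -> alg_indep Q u -> alg_indep P [tuple of f :: u].
Proof.
move=> Pi Pp Qi PQ fQ fP uQ G; have [n] := ubnP (msize G); elim: n G => // n IH G.
rewrite ltnS => Gn; rewrite {1}[G]X0_decomp rmorphD rmorphM /= comp_S_incl.
rewrite comp_mpolyXU /= => GP.
have G0 : drop_X0 G = 0.
  apply: uQ; have := PQ _ GP; rewrite addrC => h.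
  by rewrite -[_ \mPo _](addKr (f * (least_div ord0 G \mPo [tuple of f :: u])))
    addrC idealD // idealN // idealMr.
move: GP; rewrite G0 raddf0 add0r => /Pp; rewrite (negPf fP) /= => DP.
suff D0 : least_div ord0 G = 0 by rewrite [G]X0_decomp G0 D0 raddf0 mulr0 addr0.
have [//|D0] := eqVneq (least_div ord0 G) 0.
apply: IH DP; apply: leq_trans Gn.
rewrite -(mlead_deg D0); have := mlead_supp D0; set mu := mlead _.
rewrite mcoeff_msupp mcoeff_least_div => nz.
have : (mu + U_(ord0))%MM \in msupp G.
  by rewrite mcoeff_msupp; apply: contraNneq nz => ->; rewrite mul0rn.
by move/msize_mdeg_lt; rewrite mdegD mdeg1 addn1.
Qed.

(** Homogeneity isolates each term c X_i^d of a relation, and P contains neither X_i nor nonzero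
    constants. This element accounts for the extra dimension of the cone. *)
Lemma alg_indep_variable N (P : {pred {mpoly k[N.+1]}}) : is_variety P ->
  exists u : 1.-tuple {mpoly k[N.+1]}, alg_indep P u.
Proof.
case=> -[P_ideal P_homog] P_prime [i iP]; exists [tuple 'X_i] => G GP.
have powP d : 'X_i ^+ d \notin P.
  elim: d => [|d IH]; first by case: P_ideal.
  by apply/negP; rewrite exprS => /P_prime; rewrite (negPf iP) (negPf IH).
apply/mpolyP => mu; rewrite mcoeff0; apply/eqP.
have mon1 (nu : 'X_{1..1}) : mdeg nu = nu ord0 by rewrite mdegE big_ord1.
have := P_homog _ GP (mdeg mu); rewrite comp_mpoly_pihomog; last first.
  by move=> j; rewrite (tnth_nth 0) ord1 dhomogX /= mdeg1.
have -> : pihomog mdeg (mdeg mu) G = G@_mu *: 'X_[mu].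
  apply/mpolyP => nu; rewrite mcoeff_pihomog mcoeffZ mcoeffX !mon1 eq_sym.
  rewrite (_ : (mu == nu) = (mu ord0 == nu ord0)); last first.
    apply/eqP/eqP => [->//|e]; apply/mnmP => j; by rewrite ord1.
  by case: eqP => [e|_]; rewrite ?mulr0 ?mulr0n // mulr1 mulr1n;
     congr (G@__); apply/mnmP => j; rewrite ord1.
rewrite comp_mpolyZ comp_mpolyX big_ord1 (tnth_nth 0) /= -mul_mpolyC => /P_prime.
rewrite (negPf (powP _)) orbF; case: eqP => // /eqP nz cP.
case: (P_ideal) => _ /negP[]; rewrite (_ : 1 = (G@_mu)^-1%:MP * (G@_mu)%:MP).
  exact: idealMl.
by rewrite -mpolyCM mulVf.
Qed.

(** Going down from [P d], which contributes one variable, each strict inclusion adds an element. *)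
Lemma chain_alg_indep N (I : {pred {mpoly k[N.+1]}}) d : has_chain I d ->
  exists u : d.+1.-tuple {mpoly k[N.+1]}, alg_indep I u.
Proof.
case=> P [varP chainP].
suff h j : (j <= d)%N -> exists u : j.+1.-tuple {mpoly k[N.+1]}, alg_indep (P (d - j)%N) u.
  have [u uP] := h d (leqnn d); exists u => G GI; apply: uP; rewrite subnn.
  by case: (varP 0%N) => // _; apply.
elim: j => [_|j IH jd].
  by rewrite subn0; apply: alg_indep_variable; case: (varP d).
have [u uP] := IH (ltnW jd).
have e : (d - j)%N = (d - j.+1).+1 by rewrite subnSK.
have lt : (d - j.+1 < d)%N by rewrite -e leq_subr.
have [sub nsub] := chainP _ lt.
have [f [fQ fP]] : exists f, f \in P (d - j.+1).+1 /\ f \notin P (d - j.+1)%N.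
  apply: NNPP => nex; apply: nsub => f fQ; apply/negPn/negP => fP.
  by apply: nex; exists f.
have [[[Pi _] Pp _] _] := varP _ (ltnW lt).
have [[[Qi _] _ _] _] := varP _ lt.
exists [tuple of f :: u]; apply: (alg_indep_cons Pi Pp Qi sub fQ fP).
by rewrite -e.
Qed.

End Chains.

(** * Bounding algebraically independent families by counting monomials *)

Section Counting.
Variables (k : fieldType) (m : nat).
Notation R := {mpoly k[m]}.
Implicit Types (f g a : R) (b c d : 'I_m -> nat) (mu : 'X_{1..m}).

Definition bounded b f := forall mu i, (b i <= mu i)%N -> f@_mu = 0.

Lemma boundedD b f g : bounded b f -> bounded b g -> bounded b (f + g).
Proof. by move=> hf hg mu i h; rewrite mcoeffD (hf _ i) // (hg _ i) // addr0. Qed.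

Lemma bounded_sum b (T : Type) (r : seq T) (P : pred T) (F : T -> R) :
  (forall x, P x -> bounded b (F x)) -> bounded b (\sum_(x <- r | P x) F x).
Proof.
move=> h; elim/big_rec: _ => [|x f Px hf]; last exact: boundedD (h _ Px) hf.
by move=> mu i _; rewrite mcoeff0.
Qed.

Lemma boundedM b c d f g :
  (forall i x y, (b i <= x + y)%N -> (c i <= x)%N \/ (d i <= y)%N) ->
  bounded c f -> bounded d g -> bounded b (f * g).
Proof.
move=> h cf dg mu i bmu; rewrite mcoeffM big1 // => -[m1 m2] /= /eqP e.
have bm : (b i <= m1 i + m2 i)%N by rewrite -mnmDE -e.
have [cm|dm] := h _ _ _ bm; last by rewrite (dg _ i) // mulr0.
by rewrite (cf _ i) // mul0r.
Qed.

Lemma boundedZ b x f : bounded b f -> bounded b (x *: f).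
Proof. by move=> h mu i le; rewrite mcoeffZ (h _ i) // mulr0. Qed.

Lemma boundedX b mu : (forall i, mu i < b i)%N -> bounded b 'X_[mu].
Proof.
move=> h nu i le; rewrite mcoeffX; case: eqP => // e.
by move: le; rewrite -e leqNgt h.
Qed.

Lemma msizeM_leq f g : (msize (f * g) <= (msize f + msize g).-1)%N.
Proof.
have [->|f0] := eqVneq f 0; first by rewrite mul0r msize0.
have [->|g0] := eqVneq g 0; first by rewrite mulr0 msize0.
by rewrite msizeM.
Qed.

Lemma msize_prod_le (T : finType) (F : T -> R) :
  (msize (\prod_x F x) <= (\sum_x msize (F x)).+1)%N.
Proof.
elim/big_rec2: _ => [|x n f _ IH]; first by rewrite msize1.
by apply: leq_trans (msizeM_leq _ _) _; move: IH; lia.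
Qed.

Lemma msize_exp_le f n : (msize (f ^+ n) <= (n * msize f).+1)%N.
Proof.
elim: n => [|n IH]; first by rewrite expr0 msize1.
rewrite exprS; apply: leq_trans (msizeM_leq _ _) _.
by move: IH; rewrite mulSn; lia.
Qed.

Lemma bounded_le b c f : (forall i, b i <= c i)%N -> bounded b f -> bounded c f.
Proof. by move=> h hf mu i le; apply: (hf mu i); apply: leq_trans le. Qed.

Variables (I : {pred R}) (Pv : {set 'I_m}).
Hypotheses (I_ideal : idealr_closed I) (I_prime : prime_idealr_closed I).

(** A retraction onto the subring generated by the variables outside Pv; applying it to coefficients
    places them in that subring without introducing another ring. *)
Definition elim_vars : R -> R :=
  comp_mpoly [tuple (if i \in Pv then 0 else 'X_i) | i < m].

HB.instance Definition _ := GRing.RMorphism.on elim_vars.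
HB.instance Definition _ := GRing.Linear.on elim_vars.

Lemma elim_varsX i : elim_vars 'X_i = if i \in Pv then 0 else 'X_i.
Proof. by rewrite /elim_vars comp_mpolyXU -tnth_nth tnth_mktuple. Qed.

(** Exponent bounds are strict: pivots do not occur, and free variables have exponent at most D. *)
Definition free_bound D (i : 'I_m) := if i \in Pv then 1%N else D.+1.

Lemma elim_vars_bounded f : bounded (free_bound (msize f)) (elim_vars f).
Proof.
rewrite /elim_vars comp_mpolyE big_seq; apply: bounded_sum => mu mu_f.
apply: boundedZ.
have -> : \prod_i tnth [tuple (if i0 \in Pv then 0 else 'X_i0) | i0 < m] i ^+ mu i =
    if [forall i in Pv, mu i == 0%N] then 'X_[mu] else 0 :> R.
  case: ifP => [/forallP z|/negbT].
    rewrite mpolyXE_id; apply: eq_bigr => i _; rewrite tnth_mktuple.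
    by have := z i; case: ifP => //= _ /eqP ->.
  rewrite negb_forall => /existsP[i]; rewrite negb_imply => /andP[iP nz].
  by rewrite (bigD1 i) //= tnth_mktuple iP expr0n (negPf nz) mul0r.
case: ifP => [/forallP z|_]; last by move=> nu i _; rewrite mcoeff0.
apply: boundedX => i; rewrite /free_bound.
have := z i; case: ifP => [_ /= /eqP -> //|_ _].
apply: leq_trans (ltnW (msize_mdeg_lt mu_f)).
by rewrite mdegE (bigD1 i) //= leq_addr.
Qed.

Lemma leq_exp2rW (x y n : nat) : (x <= y)%N -> (x ^ n <= y ^ n)%N.
Proof. by case: n => // n xy; rewrite leq_exp2r. Qed.

(* Modulo I, a X_i^(e i) is a combination of lower powers of X_i. Hence a^n f, for f of
   degree at most n, is congruent to a polynomial supported in a box of O(n^c)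
   monomials, where c = #|~: Pv|. *)
Section Box.
Variables (e : 'I_m -> nat) (a : R) (rel : 'I_m -> nat -> R) (delta : nat).
Hypothesis e_gt0 : forall i, i \in Pv -> (0 < e i)%N.
Hypothesis a_free : bounded (free_bound delta) a.
Hypothesis rel_free : forall i j, i \in Pv -> (j < e i)%N ->
  bounded (free_bound delta) (rel i j).
Hypothesis relP : forall i, i \in Pv ->
  a * 'X_i ^+ e i - \sum_(j < e i) rel i j * 'X_i ^+ j \in I.

Definition box D (i : 'I_m) := if i \in Pv then e i else D.+1.

Definition in_box D f := exists2 g, f - g \in I & bounded (box D) g.

Lemma in_boxD D f g : in_box D f -> in_box D g -> in_box D (f + g).
Proof.
case=> f' fI bf [g' gI bg]; exists (f' + g'); last exact: boundedD.
by rewrite opprD addrACA idealD.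
Qed.

Lemma in_box_sum D (T : Type) (r : seq T) (P : pred T) (F : T -> R) :
  (forall x, P x -> in_box D (F x)) -> in_box D (\sum_(x <- r | P x) F x).
Proof.
move=> h; elim/big_rec: _ => [|x f Px hf]; last exact: in_boxD (h _ Px) hf.
by exists 0; [rewrite subr0 ideal0 | move=> mu i _; rewrite mcoeff0].
Qed.

Lemma in_box_cong D f g : f - g \in I -> in_box D g -> in_box D f.
Proof.
move=> fgI [h ghI bh]; exists h => //.
by rewrite -(subrK g f) -addrA idealD.
Qed.

Lemma in_box_le D D' f : (D <= D')%N -> in_box D f -> in_box D' f.
Proof.
move=> le [g fg bg]; exists g => //; apply: bounded_le bg => i.
by rewrite /box; case: ifP.
Qed.

Lemma in_boxMl D x f : bounded (free_bound delta) x -> in_box D f ->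
  in_box (D + delta)%N (x * f).
Proof.
move=> hx [g fg bg]; exists (x * g); first by rewrite -mulrBr idealMl.
apply: (boundedM _ hx bg) => i y z; rewrite /box /free_bound; case: ifP => _; lia.
Qed.

Lemma in_boxZ D x f : in_box D f -> in_box D (x *: f).
Proof.
move=> [g fg bg]; exists (x *: g); last exact: boundedZ.
by rewrite -scalerBr -mul_mpolyC idealMl.
Qed.

(** Each factor a pays for one variable. It is spent on [relP] when the exponent of a pivot reaches
    [e i], and absorbed by the free variables otherwise; these grow by at most [delta], plus 1 for
    X_i itself. *)
Lemma in_box_var D i f : in_box D f -> in_box (D + delta.+1)%N (a * ('X_i * f)).
Proof.
have [iP|iP] := boolP (i \in Pv); last first.
  case=> g fg bg; rewrite -addSnnS; apply: in_boxMl => //; exists ('X_i * g).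
    by rewrite -mulrBr idealMl.
  have hX : bounded (fun j => (i == j).+1) 'X_i by apply: boundedX => j; rewrite mnm1E.
  apply: (boundedM _ hX bg) => j x y; rewrite /box; case: eqP => [<-|_].
    by rewrite (negPf iP); lia.
  by case: ifP => _; lia.
case=> g fg bg; apply: (@in_box_cong _ _ (a * ('X_i * g))).
  by rewrite -!mulrBr !idealMl.
rewrite addnS; apply: (in_box_le (leqnSn _)).
rewrite {1}(mpolyE g) !mulr_sumr big_seq; apply: in_box_sum => mu; rewrite mcoeff_msupp => nz.
have mu_b j : (mu j < box D j)%N.
  by rewrite ltnNge; apply: contra nz => le; rewrite (bg _ j).
rewrite -!scalerAr; apply: in_boxZ.
case: (ltnP (mu i).+1 (e i)) => [lt|ge].
  apply: in_boxMl => //; exists ('X_i * 'X_[mu]); first by rewrite subrr ideal0.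
  rewrite -mpolyXD; apply: boundedX => j; rewrite mnmDE mnm1E.
  case: eqP => [<-|_]; last by rewrite add0n.
  by rewrite /box iP add1n.
have eE : e i = (mu i).+1.
  by apply/eqP; rewrite eqn_leq ge; have := mu_b i; rewrite /box iP => ->.
pose nu := [multinom (if j == i then 0%N else mu j) | j < m].
have muE : 'X_[mu] = 'X_i ^+ mu i * 'X_[nu] :> R.
  rewrite mpolyXn -mpolyXD; congr 'X_[_]; apply/mnmP => j.
  rewrite mnmDE mulmnE mnm1E mnmE eq_sym; case: eqP => [->|_].
    by rewrite mul1n addn0.
  by rewrite mul0n add0n.
apply: (@in_box_cong _ _ (\sum_(j < e i) rel i j * ('X_i ^+ j * 'X_[nu]))).
  rewrite (_ : _ - _ = (a * 'X_i ^+ e i - \sum_(j < e i) rel i j * 'X_i ^+ j) * 'X_[nu]).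
    by apply: idealMr => //; apply: relP.
  have -> : a * ('X_i * 'X_[mu]) = a * 'X_i ^+ e i * 'X_[nu].
    by rewrite muE eE exprS; ring.
  rewrite mulrBl mulr_suml; congr (_ - _).
  by apply: eq_bigr => j _; rewrite mulrA.
apply: in_box_sum => j _; apply: in_boxMl; first exact: rel_free.
exists ('X_i ^+ j * 'X_[nu]); first by rewrite subrr ideal0.
rewrite mpolyXn -mpolyXD; apply: boundedX => l; rewrite mnmDE mulmnE mnm1E mnmE eq_sym.
case: eqP => [->|_]; first by rewrite mul1n addn0 /box iP.
by rewrite mul0n add0n.
Qed.

Lemma in_box_monomial n mu : mdeg mu = n -> in_box (n * delta.+1)%N (a ^+ n * 'X_[mu]).
Proof.
elim: n mu => [|n IH] mu mun.
  move/eqP: mun; rewrite mdeg_eq0 => /eqP ->; rewrite mpolyX0 mulr1 expr0.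
  exists 1; first by rewrite subrr ideal0.
  rewrite -mpolyX0; apply: boundedX => i; rewrite mnm0E /box.
  by case: ifP => // /e_gt0.
have [i nz] : exists i, mu i != 0%N.
  apply/existsP; apply: contraPT mun => /existsPn z.
  rewrite mdegE big1 // => i _; apply/eqP; rewrite -[_ == _]negbK; exact: z.
have le : (U_(i) <= mu)%MM by rewrite lep1mP.
have nun : mdeg (mu - U_(i))%MM = n.
  by have := congr1 (@mdeg _) (submK le); rewrite mdegD mdeg1 mun addn1 => -[].
have := in_box_var i (IH _ nun); rewrite -mulSnr.
rewrite (_ : a * _ = a ^+ n.+1 * 'X_[mu]) //.
by rewrite -{2}(submK le) mpolyXD exprS; ring.
Qed.

(** A monomial of degree below n leaves factors a over, which only enlarge the box in the free
    directions. *)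
Lemma in_box_poly n f : (msize f <= n.+1)%N -> in_box (n * delta.+1)%N (a ^+ n * f).
Proof.
move=> fn; rewrite {1}(mpolyE f) mulr_sumr big_seq; apply: in_box_sum => mu mu_f.
rewrite -scalerAr; apply: in_boxZ.
have mun : (mdeg mu <= n)%N by rewrite -ltnS (leq_trans (msize_mdeg_lt mu_f)).
have [l ->] : exists l, n = (mdeg mu + l)%N by exists (n - mdeg mu)%N; rewrite subnKC.
elim: l => [|l IH]; first by rewrite addn0; apply: in_box_monomial.
rewrite addnS exprS -mulrA mulSnr.
by apply: in_box_le (in_boxMl a_free IH); rewrite leq_add2l.
Qed.

Lemma card_box D : (\prod_i box D i = (\prod_(i in Pv) e i) * D.+1 ^ #|~: Pv|)%N.
Proof.
rewrite (bigID (fun i => i \in Pv)) /=; congr (_ * _)%N.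
  by apply: eq_bigr => i; rewrite /box => ->.
rewrite (eq_bigr (fun=> D.+1)) => [|i /negPf iP]; last by rewrite /box iP.
rewrite (eq_bigl (fun i => i \in ~: Pv)) => [|i]; last by rewrite inE.
by rewrite prod_nat_const.
Qed.

(** If the monomials in u with exponents below d outnumbered those of the box, their multiples by
    a^n would be linearly dependent modulo I. As I is prime and a is not in I, a^n cancels, leaving
    a relation between the u's. *)
Lemma indep_monomials_box r (u : r.-tuple R) (d n D : nat) : a \notin I -> alg_indep I u ->
  (forall x : {ffun 'I_r -> 'I_d}, (msize (\prod_i tnth u i ^+ x i) <= n.+1)%N) ->
  (n * delta.+1 <= D)%N -> (d ^ r <= \prod_i box D i)%N.
Proof.
move=> aI u_indep un nD.
have /fin_all_exists2[g gI gb] (x : {ffun 'I_r -> 'I_d}) :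
    in_box D (a ^+ n * \prod_i tnth u i ^+ x i).
  by apply: in_box_le nD _; apply: in_box_poly.
have <- : #|{ffun 'I_r -> 'I_d}| = (d ^ r)%N by rewrite card_ffun !card_ord.
have <- : #|{dffun forall i, 'I_(box D i)}| = (\prod_i box D i)%N.
  rewrite card_dep_ffun foldrE big_map big_enum /=.
  by apply: eq_bigr => i _; rewrite card_ord.
pose mon (t : {dffun forall i, 'I_(box D i)}) := [multinom (t i : nat) | i < m].
pose x (j : 'I_#|{: {ffun 'I_r -> 'I_d}}|) := g (enum_val j).
pose y j : {ffun {dffun forall i, 'I_(box D i)} -> k^o} := [ffun t => (x j)@_(mon t) : k^o].
apply: (@dim_le_ffun k {dffun forall i, 'I_(box D i)} _ y) => // c cx.
have gc0 : \sum_j c j *: x j = 0.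
  apply/mpolyP => mu; rewrite mcoeff0 raddf_sum /=.
  have [/forallP mu_b|/forallPn[i mu_b]] := boolP [forall i, (mu i < box D i)%N].
    pose t : {dffun forall i, 'I_(box D i)} := [ffun i => Ordinal (mu_b i)].
    have mut : mon t = mu by apply/mnmP => i; rewrite mnmE ffunE.
    have /ffunP/(_ t) := cx; rewrite sum_ffunE !ffunE => E; rewrite -[RHS]E.
    by apply: eq_bigr => j _; rewrite !ffunE mut mcoeffZ.
  by apply: big1 => j _; rewrite mcoeffZ (gb _ mu i) ?mulr0 // leqNgt.
pose G : {mpoly k[r]} :=
  \sum_j c j *: 'X_[[multinom (enum_val j i : nat) | i < r]].
have G0 : G = 0.
  apply: u_indep.
  have : a ^+ n * (G \mPo u) \in I.
    rewrite -[_ * _]subr0 -gc0 /G raddf_sum mulr_sumr -sumrB.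
    apply: ideal_sum => // j _; rewrite /= comp_mpolyZ comp_mpolyX -scalerAr -scalerBr.
    rewrite -mul_mpolyC; apply: idealMl => //.
    rewrite (eq_bigr (fun i => tnth u i ^+ (enum_val j i : nat))) => [|i _]; last by rewrite mnmE.
    exact: gI.
  elim: (n) => [|l IH]; first by rewrite expr0 mul1r.
  by rewrite exprS -mulrA => /I_prime; rewrite (negPf aI) /= => /IH.
move=> j; have := congr1 (mcoeff [multinom (enum_val j i : nat) | i < r]) G0.
rewrite mcoeff0 raddf_sum (bigD1 j) //= mcoeffZ mcoeffX eqxx mulr1 big1 ?addr0 // => l lj.
rewrite mcoeffZ mcoeffX; case: eqP => [/mnmP E|]; last by rewrite mulr0.
case/eqP: lj; apply: enum_val_inj; apply/ffunP => i; apply: val_inj.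
by have := E i; rewrite !mnmE.
Qed.

Lemma box_count r (u : r.-tuple R) : a \notin I -> alg_indep I u -> (r + #|Pv| <= m)%N.
Proof.
move=> aI u_indep; have em : (#|Pv| + #|~: Pv|)%N = m by rewrite cardsC card_ord.
suff : (r <= #|~: Pv|)%N by move: em; lia.
rewrite leqNgt; apply/negP => cr.
set c := #|~: Pv| in cr *; pose Q := (\sum_i msize (tnth u i))%N.
(* n bounds the degree of the monomials in u with exponents below d, and B gives n * delta.+1 + 1 <=
   d * B. The choice d > M * B^c contradicts d^(c+1) <= M * (d * B)^c. *)
pose B := (r * Q.+1 * delta.+1).+1; pose M := (\prod_(i in Pv) e i)%N.
pose d := (M * B ^ c).+1; pose n := (d * (r * Q.+1))%N.
have un (x : {ffun 'I_r -> 'I_d}) : (msize (\prod_i tnth u i ^+ x i) <= n.+1)%N.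
  apply: leq_trans (msize_prod_le _) _; rewrite ltnS.
  rewrite /n mulnCA -[r in (r * _)%N]card_ord -sum_nat_const; apply: leq_sum => i _.
  apply: leq_trans (msize_exp_le _ _) _; rewrite mulnS addnC -addn1.
  apply: leq_add; last by [].
  apply: leq_mul; first exact: ltnW.
  by rewrite /Q (bigD1 i) //= leq_addr.
have := indep_monomials_box aI u_indep un (leqnn _).
rewrite card_box -/c -/M => le.
have le1 : (d ^ c.+1 <= M * (d * B) ^ c)%N.
  apply: leq_trans (leq_pexp2l _ cr) _ => //; apply: leq_trans le _.
  by rewrite leq_mul2l; apply/orP; right; apply: leq_exp2rW; rewrite /n /B; nia.
move: le1; rewrite expnMn mulnCA [(d ^ c * _)%N]mulnC expnS leq_pmul2r ?expn_gt0 //.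
by rewrite /d ltnn.
Qed.

End Box.

(** Terms whose reduced coefficient lies in I are discarded, and the top remaining one is taken as
    leading. Its exponent is positive, since otherwise that coefficient alone would be in I. *)
Lemma leading_relation i : (exists P : {poly R}, (map_poly elim_vars P).['X_i] \in I /\
    exists j, elim_vars P`_j \notin I) ->
  exists q : nat * (nat -> R), [/\ (0 < q.1)%N, elim_vars (q.2 q.1) \notin I &
    elim_vars (q.2 q.1) * 'X_i ^+ q.1 +
      \sum_(j < q.1) elim_vars (q.2 j) * 'X_i ^+ j \in I].
Proof.
case=> P [PI exj].
have jP j : elim_vars P`_j \notin I -> (j <= size P)%N.
  by apply: contraR; rewrite -ltnNge => /ltnW le; rewrite nth_default // raddf0 ideal0.
case: (ex_maxnP exj jP) => e ePI emax.
have sP : (size (map_poly elim_vars P) <= e.+1 + size P)%N.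
  by apply: leq_trans (size_poly _ _) _; rewrite leq_addl.
have relI : \sum_(j < e.+1) elim_vars P`_j * 'X_i ^+ j \in I.
  move: PI; rewrite (horner_coef_wide _ sP) big_split_ord /=.
  rewrite (eq_bigr (fun j : 'I_e.+1 => elim_vars P`_j * 'X_i ^+ j)) => [|j _]; last first.
    by rewrite coef_map.
  set t := (X in _ + X); move=> h; have tI : t \in I.
    apply: ideal_sum => // j _; apply: idealMr => //; rewrite coef_map.
    by apply: contraT => /emax /=; rewrite ltnNge leq_addr.
  by rewrite -(addrK t (\sum_(j < _) _)); apply: idealB.
exists (e, fun j => P`_j); split=> //=.
  rewrite lt0n; apply: contra ePI => /eqP e0; move: relI; rewrite e0 big_ord1.
  by rewrite expr0 mulr1.
by move: relI; rewrite big_ord_recr addrC.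
Qed.

Theorem alg_indep_bound r (u : r.-tuple R) :
  (forall i, i \in Pv -> exists P : {poly R}, (map_poly elim_vars P).['X_i] \in I /\
    exists j, elim_vars P`_j \notin I) ->
  alg_indep I u -> (r + #|Pv| <= m)%N.
Proof.
move=> Pv_alg u_indep.
have /fin_all_exists[q qP] i : exists q : nat * (nat -> R), i \in Pv ->
    [/\ (0 < q.1)%N, elim_vars (q.2 q.1) \notin I & elim_vars (q.2 q.1) * 'X_i ^+ q.1 +
      \sum_(j < q.1) elim_vars (q.2 j) * 'X_i ^+ j \in I].
  have [iP|iP] := boolP (i \in Pv); last by exists (0%N, fun=> 0).
  by have [q qP] := leading_relation (Pv_alg i iP); exists q.
pose e i := (q i).1; pose lc i := (q i).2 (e i).
(* The counting needs one multiplier for all pivots: each relation is multiplied by the leading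
   coefficients of the others. *)
pose A := \prod_(i in Pv) lc i.
pose rel0 i (j : nat) := - ((\prod_(l in Pv | l != i) lc l) * (q i).2 j).
pose delta := (msize A + \sum_i \sum_(j < e i) msize (rel0 i j))%N.
have prodI (S : pred 'I_m) : (forall i, S i -> i \in Pv) ->
    elim_vars (\prod_(i | S i) lc i) \notin I.
  move=> SP; rewrite rmorph_prod; elim/big_rec: _ => [|i x Si xI].
    by case: I_ideal.
  by apply/negP => /I_prime; rewrite (negPf xI) orbF; case: (qP i (SP i Si)) => _ /negPf ->.
apply: (@box_count e (elim_vars A) (fun i j => elim_vars (rel0 i j)) delta _ _ _ _ r u _ u_indep).
- by move=> i /qP[].
- apply: bounded_le (@elim_vars_bounded A) => i; rewrite /free_bound; case: ifP => // _.
  by rewrite ltnS leq_addr.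
- move=> i j _ je; apply: bounded_le (@elim_vars_bounded (rel0 i j)) => l.
  rewrite /free_bound; case: ifP => // _.
  rewrite ltnS /delta (bigD1 i) //= (bigD1 (Ordinal je)) //=.
  by rewrite addnCA -!addnA leq_addr.
- move=> i iP; have [_ _ relI] := qP i iP.
  have -> : elim_vars A * 'X_i ^+ e i - \sum_(j < e i) elim_vars (rel0 i j) * 'X_i ^+ j =
     elim_vars (\prod_(l in Pv | l != i) lc l) * (elim_vars (lc i) * 'X_i ^+ e i +
       \sum_(j < e i) elim_vars ((q i).2 j) * 'X_i ^+ j).
    rewrite mulrDr mulr_sumr -sumrN /A (bigD1 i) //= rmorphM; congr (_ + _); first by ring.
    by apply: eq_bigr => j _; rewrite rmorphN rmorphM /=; ring.
  exact: idealMl.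
- exact: prodI.
Qed.

End Counting.

(** * The Jacobian criterion *)

Section BasisModIdeal.
Variables (A R : comNzRingType) (psi : {rmorphism A -> R}) (I : {pred R}).
Hypotheses (I_ideal : idealr_closed I) (I_prime : prime_idealr_closed I).

(** Linear algebra over the fraction field of the image of A in R/I, with denominators cleared: e is
    a basis of the span of s and q a common denominator. *)
Lemma basis_mod_ideal (s : seq R) : exists r (e : 'I_r -> R) (q : A),
  [/\ psi q \notin I,
      forall c, c \in s -> exists p : 'I_r -> A, psi q * c - \sum_j psi (p j) * e j \in I &
      forall a : 'I_r -> A, \sum_j psi (a j) * e j \in I -> forall j, psi (a j) \in I].
Proof.
elim: s => [|c s [r [e [q [qI gen ind]]]]].
  exists 0%N, (fun=> 0), 1; split=> [||a _ []] //; rewrite rmorph1.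
  by case: I_ideal.
(* Either c depends on e, and its denominator a0 is absorbed into q, or c joins the basis. *)
have [[a0 [a [a0I caI]]]|nex] := classic (exists a0 (a : 'I_r -> A),
    psi a0 \notin I /\ psi a0 * c - \sum_j psi (a j) * e j \in I).
  exists r, e, (q * a0); split=> //.
    by rewrite rmorphM; apply/negP => /I_prime; rewrite (negPf qI) (negPf a0I).
  move=> x; rewrite in_cons => /predU1P[->|/gen[p pI]].
    exists (fun j => q * a j); rewrite rmorphM -mulrA.
    rewrite (eq_bigr (fun j => psi q * (psi (a j) * e j))) => [|j _]; last first.
      by rewrite rmorphM mulrA.
    by rewrite -mulr_sumr -mulrBr; apply: idealMl.
  exists (fun j => a0 * p j); rewrite rmorphM [psi q * _]mulrC -mulrA.
  rewrite (eq_bigr (fun j => psi a0 * (psi (p j) * e j))) => [|j _]; last first.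
    by rewrite rmorphM mulrA.
  by rewrite -mulr_sumr -mulrBr; apply: idealMl.
exists r.+1, (fun i => oapp e c (unlift ord0 i)), q; split=> //.
  move=> x; rewrite in_cons => /predU1P[->|/gen[p pI]].
    exists (fun i => if i == ord0 then q else 0).
    rewrite big_ord_recl /= unlift_none /= big1 => [|j _]; last by rewrite rmorph0 mul0r.
    by rewrite addr0 subrr ideal0.
  exists (fun i => oapp p 0 (unlift ord0 i)).
  rewrite big_ord_recl /= unlift_none /= rmorph0 mul0r add0r.
  by under eq_bigr do rewrite liftK.
move=> a; rewrite big_ord_recl unlift_none /=.
under eq_bigr do rewrite liftK /=.
move=> aI; have a0I : psi (a ord0) \in I.
  apply: contraT => a0I; case: nex; exists (a ord0), (fun j => - a (lift ord0 j)).
  split=> //; rewrite -sumrN; under eq_bigr do rewrite rmorphN mulNr opprK.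
  exact: aI.
have {}aI : \sum_j psi (a (lift ord0 j)) * e j \in I.
  by rewrite -[X in X \in I](addKr (psi (a ord0) * c)) addrC idealB // idealMr.
move=> i; case: (unliftP ord0 i) => [j ->|->] //.
exact: (ind (fun j => a (lift ord0 j)) aI).
Qed.

Variable m : nat.
Implicit Types (F G : {mpoly R[m]}).

Definition coeffs_in F := forall mu, F@_mu \in I.

Lemma coeffs_inD F G : coeffs_in F -> coeffs_in G -> coeffs_in (F + G).
Proof. by move=> hF hG mu; rewrite mcoeffD idealD. Qed.

Lemma coeffs_inB F G : coeffs_in F -> coeffs_in G -> coeffs_in (F - G).
Proof. by move=> hF hG mu; rewrite mcoeffB idealB. Qed.

Lemma coeffs_inMl F G : coeffs_in F -> coeffs_in (G * F).
Proof. by move=> hF mu; rewrite mcoeffM ideal_sum // => i _; apply: idealMl. Qed.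

Lemma coeffs_in_sum (T : Type) (r : seq T) (P : pred T) (E : T -> {mpoly R[m]}) :
  (forall x, P x -> coeffs_in (E x)) -> coeffs_in (\sum_(x <- r | P x) E x).
Proof. by move=> h mu; rewrite raddf_sum; apply: ideal_sum => // x Px; apply: h. Qed.

Lemma coeffs_inC c : c \in I -> coeffs_in c%:MP.
Proof. by move=> cI mu; rewrite mcoeffC idealMr. Qed.

Lemma coeffs_in_meval F v : coeffs_in F -> F.@[v] \in I.
Proof. by move=> hF; rewrite mevalE ideal_sum // => mu _; apply: idealMr. Qed.

Lemma basis_mod_mpoly (X : finType) (W : X -> {mpoly R[m]}) : exists r (e : 'I_r -> R) (q : A),
  [/\ psi q \notin I,
      forall i, exists P : 'I_r -> {mpoly A[m]},
        coeffs_in ((psi q)%:MP * W i - \sum_j map_mpoly psi (P j) * (e j)%:MP) &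
      forall a : 'I_r -> A, \sum_j psi (a j) * e j \in I -> forall j, psi (a j) \in I].
Proof.
have [r [e [q [qI gen ind]]]] :=
  basis_mod_ideal (flatten [seq [seq (W i)@_mu | mu <- msupp (W i)] | i <- enum X]).
exists r, e, q; split=> // i.
have gen_i mu : mu \in msupp (W i) ->
    exists p : 'I_r -> A, psi q * (W i)@_mu - \sum_j psi (p j) * e j \in I.
  move=> mu_W; apply: gen; apply/flatten_mapP; exists i; first by rewrite mem_enum.
  exact: map_f.
rewrite (mpolyE (W i)); elim: (msupp (W i)) gen_i => [|mu s IH] gen_i.
  exists (fun=> 0); rewrite big_nil mulr0 big1 ?subrr => [|j _].
    by move=> mu; rewrite mcoeff0 ideal0.
  by rewrite raddf0 mul0r.
have [p pI] := gen_i mu (mem_head _ _).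
have [nu nu_s|P PI] := IH; first by apply: gen_i; rewrite in_cons nu_s orbT.
exists (fun j => (p j)%:MP * 'X_[mu] + P j); rewrite big_cons.
have -> : (psi q)%:MP * ((W i)@_mu *: 'X_[mu] + \sum_(m0 <- s) (W i)@_m0 *: 'X_[m0]) -
    \sum_j map_mpoly psi ((p j)%:MP * 'X_[mu] + P j) * (e j)%:MP =
  'X_[mu] * (psi q * (W i)@_mu - \sum_j psi (p j) * e j)%:MP +
  ((psi q)%:MP * (\sum_(m0 <- s) (W i)@_m0 *: 'X_[m0]) -
    \sum_j map_mpoly psi (P j) * (e j)%:MP).
  rewrite (eq_bigr (fun j => 'X_[mu] * (psi (p j) * e j)%:MP +
      map_mpoly psi (P j) * (e j)%:MP)) => [|j _]; last first.
    by rewrite rmorphD rmorphM /= map_mpolyC map_mpolyX mpolyCM; ring.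
  rewrite big_split /= -mulr_sumr mpolyCB mpolyCM [(\sum_j _)%:MP]raddf_sum /=.
  by rewrite -mul_mpolyC; ring.
by apply: coeffs_inD => //; apply: coeffs_inMl; apply: coeffs_inC.
Qed.

End BasisModIdeal.

Section Jacobian.
Variables (k : fieldType) (m : nat).
Notation R := {mpoly k[m]}.
(* Polynomials in a second set of variables Z, with coefficients in R = k[x]. *)
Notation T := {mpoly R[m]}.
Implicit Types (f g : R) (F : T).

Notation in_Z := (map_mpoly (@mpolyC m k)).
Notation at_x := (meval (fun i : 'I_m => 'X_i : R)).
Notation dX i := ('X_i - ('X_i)%:MP : T).

Lemma at_x_in_Z f : at_x (in_Z f) = f.
Proof.
rewrite [in LHS](mpolyE f) [in_Z _]raddf_sum [at_x _]raddf_sum [RHS]mpolyE /=.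
apply: eq_bigr => mu _; rewrite -mul_mpolyC rmorphM /= map_mpolyC map_mpolyX.
by rewrite mevalM mevalC mevalX -mpolyXE_id mul_mpolyC.
Qed.

(** First-order Taylor expansion of f(Z) at x without denominators, valid in every
    characteristic. *)
Definition divided_difference f (M : 'I_m -> T) :=
  in_Z f - f%:MP = \sum_i M i * dX i /\ forall i, at_x (M i) = f^`M(i).

Lemma divided_differenceM f g M M' : divided_difference f M -> divided_difference g M' ->
  divided_difference (f * g) (fun i => M i * in_Z g + f%:MP * M' i).
Proof.
case=> fE Mf [gE Mg]; split=> [|i]; last first.
  by rewrite mevalD !mevalM mevalC at_x_in_Z Mf Mg mderivM.
have E1 (a b c d : T) : a * b - c * d = b * (a - c) + c * (b - d) by ring.
have E2 (a b c d e : T) : a * (b * c) + d * (e * c) = (b * a + d * e) * c by ring.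
rewrite [in_Z _]rmorphM mpolyCM E1.
rewrite (congr2 (fun a b => in_Z g * a + f%:MP * b) fE gE) !mulr_sumr -big_split.
by apply: eq_bigr => i _; apply: E2.
Qed.

Lemma divided_differenceD f g M M' : divided_difference f M -> divided_difference g M' ->
  divided_difference (f + g) (fun i => M i + M' i).
Proof.
case=> fE Mf [gE Mg]; split=> [|i]; last by rewrite mevalD Mf Mg mderivD.
rewrite [in_Z _]rmorphD mpolyCD opprD addrACA (congr2 +%R fE gE) -big_split.
by apply: eq_bigr => i _; rewrite mulrDl.
Qed.

Lemma divided_differenceC c : divided_difference c%:MP (fun=> 0).
Proof.
split=> [|i]; last by rewrite meval0 mderivC.
by rewrite map_mpolyC subrr big1 // => i _; rewrite mul0r.
Qed.

Lemma divided_differenceX i : divided_difference 'X_i (fun j => (j == i)%:R).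
Proof.
split=> [|j].
  by rewrite (bigD1 i) //= eqxx mul1r map_mpolyX big1 ?addr0 // => j /negPf ->; rewrite mul0r.
rewrite mderivX mnm1E eq_sym; case: eqP => [<-|_]; last by rewrite meval0 scale0r.
have -> : (U_(i) - U_(i) = 0 :> 'X_{1..m})%MM by apply/mnmP => l; rewrite mnmBE mnm0E subnn.
by rewrite meval1 mpolyX0 scale1r.
Qed.

Lemma exists_divided_difference f : exists M, divided_difference f M.
Proof.
rewrite [f]mpolyE; elim/big_rec: _ => [|mu g _ [M' gM']].
  by exists (fun=> 0); rewrite -mpolyC0; apply: divided_differenceC.
suff [M XM] : exists M, divided_difference 'X_[mu] M.
  eexists; rewrite -mul_mpolyC; apply: divided_differenceD gM'.
  exact: divided_differenceM (divided_differenceC _) XM.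
rewrite mpolyXE_id; elim/big_rec: _ => [|i h _ [M hM]].
  by exists (fun=> 0); rewrite -mpolyC1; apply: divided_differenceC.
elim: (mu i) => [|n [M1 IH]]; first by exists M; rewrite expr0 mul1r.
eexists; rewrite exprS -mulrA; exact: divided_differenceM (divided_differenceX i) IH.
Qed.

Variables (I : {pred R}) (t : nat) (pv : 'I_t -> 'I_m) (fs : 'I_t -> R).
Hypotheses (I_ideal : idealr_closed I) (I_prime : prime_idealr_closed I).
Hypothesis pv_inj : injective pv.
Hypothesis fsI : forall j, fs j \in I.
Hypothesis jacobian : \det (\matrix_(j, i) (fs j)^`M(pv i)) \notin I.
Notation Pv := [set pv i | i : 'I_t].

Lemma diagonal_relation i0 : exists (g : T) (h h' : 'I_t -> T) (h'' : 'I_m -> T),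
  at_x g \notin I /\
  g * dX (pv i0) - \sum_j h j * in_Z (fs j) - \sum_(l | l \notin Pv) h'' l * dX l =
    \sum_j h' j * (fs j)%:MP.
Proof.
have /fin_all_exists[M MP] j := exists_divided_difference (fs j).
pose D : 'M[T]_t := \matrix_(j, i) M j (pv i).
pose h j := \adj D i0 j.
exists (\det D), h, (fun j => - h j), (fun l => - \sum_j h j * M j l); split.
  rewrite -(det_map_mx (meval (fun i : 'I_m => 'X_i : R))).
  rewrite (_ : map_mx _ D = \matrix_(j, i) (fs j)^`M(pv i)) //.
  by apply/matrixP => j i; rewrite !mxE; case: (MP j) => _ h'; apply: h'.
pose w j := in_Z (fs j) - (fs j)%:MP - \sum_(l | l \notin Pv) M j l * dX l.
have wE j : w j = \sum_i D j i * dX (pv i).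
  rewrite /w; case: (MP j) => -> _; rewrite (bigID (mem Pv)) /= addrK.
  rewrite big_imset /=; last by move=> x y _ _; apply: pv_inj.
  by apply: eq_bigr => i _; rewrite mxE.
have detE : \det D * dX (pv i0) = \sum_j h j * w j.
  have /matrixP/(_ i0 0) := mulmxA (\adj D) D (\col_i dX (pv i)).
  rewrite mul_adj_mx mul_scalar_mx [LHS]mxE [RHS]mxE [X in _ = _ * X]mxE => <-.
  apply: eq_bigr => j _; congr (_ * _); rewrite wE mxE.
  by apply: eq_bigr => i _; congr (_ * _); rewrite mxE.
rewrite detE.
rewrite (eq_bigr (fun l => - \sum_j h j * (M j l * dX l))) => [|l _]; last first.
  by rewrite mulNr mulr_suml; congr (- _); apply: eq_bigr => j _; rewrite mulrA.
rewrite sumrN exchange_big /= opprK -sumrB -big_split; apply: eq_bigr => j _ /=.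
by rewrite -mulr_sumr /w; ring.
Qed.

End Jacobian.

Section PolyIdeal.
Variables (R : comNzRingType) (I : {pred R}) (I_ideal : idealr_closed I).

Definition poly_coefs_in (P : {poly R}) := forall j, P`_j \in I.

Lemma poly_coefs_inMr P Q : poly_coefs_in P -> poly_coefs_in (P * Q).
Proof. by move=> h j; rewrite coefM ideal_sum // => i _; apply: idealMr. Qed.

(** The factor c - X has leading coefficient -1, so descending induction from the top puts every
    coefficient of P in I. *)
Lemma poly_coefs_in_root (P : {poly R}) c : poly_coefs_in (P * (c%:P - 'X)) -> P.[c] \in I.
Proof.
move=> h; rewrite horner_coef ideal_sum // => i _; apply: idealMr => //.
have [n le] : exists n, (size P <= i + n)%N by exists (size P); rewrite leq_addl.
elim: n {i} (i : nat) le => [|n IH] i le.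
  by rewrite nth_default ?ideal0 //; rewrite addn0 in le.
have := h i.+1; rewrite mulrBr coefB coefMC coefMX /= => hi.
rewrite -[P`_i](subKr (P`_i.+1 * c)) idealB // idealMr // IH //.
by rewrite addSnnS.
Qed.

End PolyIdeal.

Section PivotAlgebraic.
Variables (k : fieldType) (m : nat).
Notation R := {mpoly k[m]}.
Notation T := {mpoly R[m]}.
Notation A := {poly R}.
Notation TA := {mpoly A[m]}.
Variable Pv : {set 'I_m}.

(** The coefficients are restricted to the free variables and the indeterminate of A, called Y
    below, is evaluated at x_i: the image is the subring generated by x_i and the free variables. *)
Definition elim_eval i : A -> R := horner_eval 'X_i \o map_poly (elim_vars Pv).

HB.instance Definition _ i := GRing.RMorphism.on (elim_eval i).
Arguments elim_eval : simpl never.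

Lemma elim_evalC i f : elim_eval i f%:P = elim_vars Pv f.
Proof. by rewrite /elim_eval /= map_polyC /= /horner_eval hornerC. Qed.

Lemma elim_evalX i : elim_eval i 'X = 'X_i.
Proof. by rewrite /elim_eval /= map_polyX /horner_eval hornerX. Qed.

(** The specialization Z = x with Y kept indeterminate. *)
Definition elim_at_x : TA -> A := mmap (map_poly (elim_vars Pv)) (fun l => ('X_l)%:P).

HB.instance Definition _ := GRing.RMorphism.on elim_at_x.

Lemma elim_at_xC P : elim_at_x P%:MP = map_poly (elim_vars Pv) P.
Proof. exact: mmapC. Qed.

Lemma elim_at_xX l : elim_at_x 'X_l = ('X_l)%:P.
Proof. by rewrite /elim_at_x mmapX mmap1U. Qed.

Lemma elim_at_x_horner i F :
  (elim_at_x F).['X_i] = (map_mpoly (elim_eval i) F).@[fun l => 'X_l].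
Proof.
rewrite /elim_at_x /mmap horner_sum [in RHS](mpolyE F) [map_mpoly _ _]raddf_sum [RHS]raddf_sum /=.
apply: eq_bigr => mu _.
rewrite map_mpolyZ map_mpolyX mevalZ mevalX hornerM; congr (_ * _).
by rewrite /mmap1 horner_prod; apply: eq_bigr => l _; rewrite horner_exp hornerC.
Qed.

Definition in_ZA (f : R) : TA := map_mpoly (polyC \o @mpolyC m k) f.

Lemma in_ZA_elim_eval i f : map_mpoly (elim_eval i) (in_ZA f) = map_mpoly (@mpolyC m k) f.
Proof.
apply/mpolyP => mu.
transitivity (elim_eval i (f@_mu)%:MP%:P).
  by rewrite [LHS]mcoeff_map_mpoly [(in_ZA f)@_mu]mcoeff_map_mpoly.
rewrite [RHS]mcoeff_map_mpoly elim_evalC; exact: comp_mpolyC.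
Qed.

Lemma elim_at_x_in_ZA f : elim_at_x (in_ZA f) = f%:P.
Proof.
rewrite (mpolyE f) /in_ZA [map_mpoly _ _]raddf_sum [LHS]raddf_sum [RHS]raddf_sum /=.
apply: eq_bigr => mu _; rewrite map_mpolyZ map_mpolyX.
have -> : elim_at_x ((polyC \o @mpolyC m k) f@_mu *: 'X_[mu]) =
    elim_at_x ((f@_mu)%:MP%:P)%:MP * \prod_l elim_at_x 'X_l ^+ mu l.
  rewrite -mul_mpolyC rmorphM mpolyXE_id rmorph_prod; congr (_ * _).
  by apply: eq_bigr => l _; rewrite rmorphXn.
rewrite elim_at_xC map_polyC /= [elim_vars Pv _]comp_mpolyC -mul_mpolyC polyCM; congr (_ * _).
rewrite mpolyXE_id rmorph_prod; apply: eq_bigr => l _.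
by rewrite elim_at_xX rmorphXn.
Qed.

Variables (I : {pred R}) (I_ideal : idealr_closed I) (I_prime : prime_idealr_closed I).

Lemma elim_at_x_coefs_in (F : TA) : (forall mu j, elim_vars Pv (F@_mu)`_j \in I) ->
  poly_coefs_in I (elim_at_x F).
Proof.
move=> h j; rewrite /elim_at_x /mmap coef_sum ideal_sum // => mu _.
by apply: poly_coefs_inMr => // l; rewrite coef_map; apply: h.
Qed.

End PivotAlgebraic.

Arguments elim_eval : simpl never.

Section JacobianCriterion.
Variables (k : fieldType) (m : nat).
Notation R := {mpoly k[m]}.
Notation T := {mpoly R[m]}.
Notation A := {poly R}.
Notation TA := {mpoly A[m]}.
Variables (I : {pred R}) (t : nat) (pv : 'I_t -> 'I_m) (fs : 'I_t -> R).
Hypotheses (I_ideal : idealr_closed I) (I_prime : prime_idealr_closed I).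
Hypothesis pv_inj : injective pv.
Hypothesis fsI : forall j, fs j \in I.
Hypothesis jacobian : \det (\matrix_(j, i) (fs j)^`M(pv i)) \notin I.
Notation Pv := [set pv i | i : 'I_t].
Notation at_x := (meval (fun i : 'I_m => 'X_i : R)).

(** If x_i were transcendental, each component of the diagonal relation along the basis e would hold
    with Y in place of x_i. At Z = x it leaves x_i - Y times the component of g, so this component
    vanishes modulo I, and so does g, contrary to the choice of the minor. *)
Theorem pivot_algebraic i0 : exists P : {poly R},
  (map_poly (elim_vars Pv) P).['X_(pv i0)] \in I /\ exists j, elim_vars Pv P`_j \notin I.
Proof.
apply: NNPP => nex; set x0 := pv i0 in nex.
have trans (P : A) : elim_eval Pv x0 P \in I -> forall j, elim_vars Pv P`_j \in I.
  move=> PI j; apply: contraT => jI; case: nex; exists P; split=> //; by exists j.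
have [g [h [h' [h'' [gI rel]]]]] := diagonal_relation pv_inj jacobian i0.
pose X : finType := ('I_1 + ('I_t + 'I_m))%type.
pose W (x : X) := match x with inl _ => g | inr (inl j) => h j | inr (inr l) => h'' l end.
pose psi : {rmorphism A -> R} := elim_eval Pv x0.
have [r [e [q [qI gen ind]]]] := @basis_mod_mpoly A R psi I I_ideal I_prime m X W.
have [P PI] := fin_all_exists gen.
(* The factors that multiply g, h and h'' in the relation, with Y in place of ['X_x0]; c puts
   ['X_x0] back. Pivots l get 0, as they are absent from the sum over h''. *)
pose cA (x : X) : TA := match x with inl _ => 'X_x0 - 'X%:MP | inr (inl j) => - in_ZA (fs j)
  | inr (inr l) => if l \in Pv then 0 else - ('X_l - (('X_l)%:P)%:MP) end.
pose c (x : X) : T := map_mpoly (elim_eval Pv x0) (cA x).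
have cN : c (inl 0) = 'X_x0 - ('X_x0)%:MP.
  by rewrite /c /cA rmorphB /= map_mpolyX map_mpolyC /= elim_evalX.
have cl j : c (inr (inl j)) = - map_mpoly (@mpolyC m k) (fs j).
  by rewrite /c /cA rmorphN /= in_ZA_elim_eval.
have cr l : c (inr (inr l)) = if l \in Pv then 0 else - ('X_l - ('X_l)%:MP).
  rewrite /c /cA; case: ifP => [_|lP]; first exact: raddf0.
  by rewrite rmorphN rmorphB /= map_mpolyX map_mpolyC /= elim_evalC elim_varsX lP.
have Wc : coeffs_in I (\sum_x W x * c x).
  rewrite big_sumType big_ord1 big_sumType /= cN.
  have -> : \sum_(j : 'I_t) h j * c (inr (inl j)) =
      - \sum_j h j * map_mpoly (@mpolyC m k) (fs j).
    by rewrite -sumrN; apply: eq_bigr => j _; rewrite cl mulrN.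
  have -> : \sum_(l : 'I_m) h'' l * c (inr (inr l)) =
      - \sum_(l | l \notin Pv) h'' l * ('X_l - ('X_l)%:MP).
    rewrite -sumrN [RHS]big_mkcond; apply: eq_bigr => l _.
    by rewrite cr; case: (l \in Pv); rewrite ?mulr0 ?mulrN.
  rewrite addrA rel; apply: coeffs_in_sum => // j _.
  by apply: coeffs_inMl => //; apply: coeffs_inC.
(* The component of the relation along [e s]. *)
pose E s := \sum_x P x s * cA x.
have Ec : coeffs_in I (\sum_s map_mpoly psi (E s) * (e s)%:MP).
  have -> : \sum_s map_mpoly psi (E s) * (e s)%:MP =
      \sum_x (\sum_s map_mpoly psi (P x s) * (e s)%:MP) * c x.
    transitivity (\sum_s \sum_x map_mpoly psi (P x s) * (e s)%:MP * c x).
      apply: eq_bigr => s _; rewrite (raddf_sum (map_mpoly psi)) mulr_suml.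
      by apply: eq_bigr => x _; rewrite /= rmorphM mulrAC.
    by rewrite exchange_big; apply: eq_bigr => x _; rewrite mulr_suml.
  have -> : \sum_x (\sum_s map_mpoly psi (P x s) * (e s)%:MP) * c x =
      (psi q)%:MP * (\sum_x W x * c x) -
      \sum_x ((psi q)%:MP * W x - \sum_s map_mpoly psi (P x s) * (e s)%:MP) * c x.
    rewrite mulr_sumr -sumrB; apply: eq_bigr => x _.
    by rewrite mulrA -mulrBl subKr.
  apply: coeffs_inB => //; first exact: coeffs_inMl.
  by apply: coeffs_in_sum => // x _; rewrite mulrC; apply: coeffs_inMl => //; apply: PI.
(* Independence of e separates the components; [trans] then allows Y to stay indeterminate. *)
have EI s mu : psi (E s)@_mu \in I.
  apply: (ind (fun s => (E s)@_mu)); have := Ec mu; rewrite raddf_sum.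
  apply: etrans; congr (_ \in I); apply: eq_bigr => s' _ /=.
  by rewrite [map_mpoly _ _ * _]mulrC mcoeffCM mcoeff_map_mpoly mulrC.
pose Q s := elim_at_x Pv (P (inl 0) s).
(* At Z = x the terms from h'' vanish and those from h are multiples of the f_j in I, so [Q s] times
   x_i - Y has its coefficients in I. *)
have QI s : (Q s).['X_x0] \in I.
  apply: (poly_coefs_in_root I_ideal).
  have h1 : poly_coefs_in I (elim_at_x Pv (E s)).
    by apply: elim_at_x_coefs_in => // mu j; apply: trans; apply: EI.
  have h2 : poly_coefs_in I (\sum_j (fs j)%:P * elim_at_x Pv (P (inr (inl j)) s)).
    move=> j; rewrite coef_sum; apply: ideal_sum => // l _.
    by rewrite coefCM; apply: idealMr.
  have -> : Q s * (('X_x0)%:P - 'X) = elim_at_x Pv (E s) +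
      \sum_j (fs j)%:P * elim_at_x Pv (P (inr (inl j)) s).
    rewrite /E [elim_at_x _ _]raddf_sum big_sumType big_ord1 big_sumType /=.
    rewrite [X in _ + (_ + X) + _]big1 => [|l _]; last first.
      rewrite rmorphM; case: ifP => [_|lP]; first by rewrite rmorph0 mulr0.
      rewrite rmorphN rmorphB /= elim_at_xX elim_at_xC map_polyC /= elim_varsX lP.
      by rewrite subrr oppr0 mulr0.
    rewrite addr0 -addrA -big_split big1 ?addr0 => [|j _] /=; last first.
      by rewrite rmorphM rmorphN /= elim_at_x_in_ZA mulrN mulrC addNr.
    by rewrite rmorphM rmorphB /= elim_at_xX elim_at_xC map_polyX.
  by move=> j; rewrite coefD idealD.
have := coeffs_in_meval I_ideal (fun l => 'X_l) (PI (inl 0)).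
rewrite mevalB mevalM mevalC (raddf_sum (meval (fun l : 'I_m => 'X_l : R))) /= => gqI.
have : psi q * at_x g \in I.
  rewrite (idealBl I_ideal gqI); apply: ideal_sum => // s _.
  rewrite mevalM mevalC; apply: idealMr => //.
  by rewrite -elim_at_x_horner; apply: QI.
by move/I_prime; rewrite (negPf qI) (negPf gI).
Qed.

End JacobianCriterion.

(** * The inequality *)

Lemma alg_indep_coord_change (k : fieldType) N (A : 'M[k]_N.+1) (I : {pred {mpoly k[N.+1]}})
    r (u : r.-tuple {mpoly k[N.+1]}) : A \in unitmx -> alg_indep I u ->
  alg_indep (coord_change A I) (map_tuple (lin_subst A) u).
Proof.
move=> uA u_indep G GI; apply: u_indep.
rewrite -(lin_substK (G \mPo u) uA) -coord_changeE.
have -> : lin_subst A (G \mPo u) = G \mPo map_tuple (lin_subst A) u; last by [].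
rewrite !comp_mpolyE (raddf_sum (lin_subst A)); apply: eq_bigr => mu _ /=.
rewrite linearZ /= (rmorph_prod (lin_subst A)); congr (_ *: _); apply: eq_bigr => i _.
by rewrite rmorphXn tnth_map.
Qed.

Lemma deriv_base_point (k : fieldType) N (f : {mpoly k[N.+1]}) i : f \is 2.-homog ->
  (f^`M(lift ord0 i)).@[@base_point k N] = f@_(U_(ord0) + U_(lift ord0 i)).
Proof.
move=> f2; rewrite (@meval_base_point _ _ 1).
  by rewrite mulm1n mcoeff_deriv mnm1E mulr1n.
apply/dhomogP => mu; rewrite mcoeff_msupp mcoeff_deriv => nz; apply/eqP.
apply: contraNT nz => ne; rewrite (dhomog_nemf_coeff f2) ?mul0rn //=.
by rewrite mdegD mdeg1 addn1 eqSS.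
Qed.

(* The tangent space of X at a rational point has dimension at least dim X. *)
Lemma pivots_le_codim (k : fieldType) N n (I : {pred {mpoly k[N.+1]}}) t (pv : 'I_t -> 'I_N) fs
    (u : n.+1.-tuple {mpoly k[N.+1]}) :
  idealr_closed I -> prime_idealr_closed I -> (forall f, f \in I -> f.@[@base_point k N] = 0) ->
  (forall j, fs j \in I) -> (forall j, fs j \is 2.-homog) ->
  (forall i j, (fs j)@_(U_(ord0) + U_(lift ord0 (pv i))) = (i == j)%:R) ->
  alg_indep I u -> injective pv /\ (n + t <= N)%N.
Proof.
move=> I_ideal I_prime I_pt fsI fs2 fs_dual u_indep.
have pv_inj : injective pv.
  move=> i j ij; have := fs_dual i i; rewrite ij fs_dual eqxx => /eqP.
  by case: (j =P i) => // _; rewrite eq_sym oner_eq0.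
split=> //; pose pv1 i := lift ord0 (pv i) : 'I_N.+1.
have pv1_inj : injective pv1 by move=> i j /lift_inj/pv_inj.
(* By duality of the [fs] and pivots, the Jacobian matrix at the base point is the identity; a minor
   equal to 1 there cannot lie in I. *)
have jac : \det (\matrix_(j, i) (fs j)^`M(pv1 i)) \notin I.
  apply/negP => /I_pt; rewrite -det_map_mx.
  rewrite (_ : map_mx _ _ = 1%:M); first by rewrite det1 => /eqP; rewrite oner_eq0.
  by apply/matrixP => j i; rewrite !mxE /pv1 /= deriv_base_point // fs_dual eq_sym.
have alg i : i \in [set pv1 i | i : 'I_t] -> exists P : {poly {mpoly k[N.+1]}},
    (map_poly (elim_vars [set pv1 i | i : 'I_t]) P).['X_i] \in I /\
    exists j, elim_vars [set pv1 i | i : 'I_t] P`_j \notin I.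
  by case/imsetP => i0 _ ->; apply: pivot_algebraic.
by have := alg_indep_bound I_ideal I_prime alg u_indep; rewrite card_imset // card_ord.
Qed.

Theorem theorem1p1 (k : fieldType) (n e : nat)
    (I : {pred {mpoly k[(n + e).+1]}})
    (X_variety : is_variety I) (X_nondeg : nondegenerate_ideal I)
    (X_dim : has_dim I n)
    (q : 'cV[k]_((n + e).+1)) (q_on_X : on_variety I q)
    (A : 'M[k]_((n + e).+1)) (A_unit : A \in unitmx) (A_q : col ord0 A = q)
    (F : graded_resolution I)
    (G : graded_resolution (inner_projection A I))
    (p : nat) (p_ge1 : (1 <= p)%N) :
  (betti F p 1 <= betti G p 1 + betti G p.-1 1 + 'C(e, p))%N.
Proof.
have [I_homog I_prime _] := X_variety.
set I' := coord_change A I.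
have I'_homog : homogeneous_ideal I' by apply: coord_change_homogeneous.
have I'_prime : prime_idealr_closed I' by apply: coord_change_prime.
have I'_nondeg : nondegenerate_ideal I' by apply: coord_change_nondegenerate.
have I'_pt f : f \in I' -> f.@[@base_point k (n + e)] = 0.
  exact: (coord_change_base_point A_unit A_q q_on_X).
have I'_ideal : idealr_closed I' by case: I'_homog.
have [t [pv [fs [fsI fs2 fs_dual fs_piv]]]] := exists_pivots I'_ideal.
have [u u_indep] := chain_alg_indep (proj1 X_dim).
have [pv_inj te] := pivots_le_codim I'_ideal I'_prime I'_pt fsI fs2 fs_dual
  (alg_indep_coord_change A_unit u_indep).
have [F' F'E] := coord_change_resolution A_unit F.
rewrite -F'E; pose Pv := [set pv i | i : 'I_t].
have piv f : f \in I' -> f \is 2.-homog ->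
    (forall i, i \in Pv -> f@_(U_(ord0) + U_(lift ord0 i)) = 0) ->
    forall i, f@_(U_(ord0) + U_(lift ord0 i)) = 0.
  by move=> fI f2 f0; apply: fs_piv => // i; apply: f0; apply: imset_f.
(* The ideals [inner_projection A I] and [section_ideal I'] are convertible, so G serves as it
   stands. *)
have := inner_projection_betti F' G I'_homog I'_nondeg I'_pt piv p_ge1.
move/leq_trans; apply; rewrite leq_add2l card_imset // card_ord.
by apply: leq_bin2l; rewrite -(leq_add2l n).
Qed.
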